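(* Let $n\ge3$ and $1<k<n$. Let $\omega\in\Omega^{n-k}(\mathbb{C}^n,0)$ be such that $\omega(0)=0$, with $\mathrm{codim}(\mathrm{sing}(\omega))\ge2$, defining a germ of a $k$-dimensional singular distribution with locally free tangent sheaf, and let $X\in\mathcal{X}(\mathbb{C}^n,0)$ satisfy $i_X\omega=0$. If $\mathrm{rank}(DX(0))\ge k$, then $X$ divides $\omega$.
   Context: $\Omega^{q}(\mathbb{C}^n,0)$ and $\mathcal{X}(\mathbb{C}^n,0)$ denote germs at $0$ of holomorphic $q$-forms and of holomorphic vector fields. $\mathrm{sing}(\omega)=\{\omega=0\}$. The germ $\omega\in\Omega^{n-k}(\mathbb{C}^n,0)$ with $\mathrm{codim}(\mathrm{sing}(\omega))\ge2$ defines a germ of $k$-dimensional distribution if a representative is locally decomposable off its singular set: near each point where it is nonzero it equals $\eta_1\wedge\cdots\wedge\eta_{n-k}$ for holomorphic $1$-forms $\eta_i$. The distribution has locally free tangent sheaf if the $\mathcal{O}_{\mathbb{C}^n,0}$-module $\{v\in\mathcal{X}(\mathbb{C}^n,0):i_v\omega=0\}$ is free. $X$ divides $\omega$ if there is $\Theta\in\Omega^{n-k+1}(\mathbb{C}^n,0)$ such that $\omega=i_X\Theta$. *)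

(* Defs.v *)
From HB Require Import structures.
From mathcomp Require Import all_boot all_order all_algebra.
From mathcomp Require Import all_classical all_reals all_analysis.
From mathcomp Require Export complex.

Set Implicit Arguments.
Unset Strict Implicit.
Unset Printing Implicit Defensive.

Import Order.TTheory GRing.Theory Num.Theory.
Import numFieldNormedType.Exports.

Local Open Scope classical_set_scope.
Local Open Scope ring_scope.

(* Local complex analytic geometry, written over a numFieldType K and meant to
   be used with K the complex numbers R[i], R : realType: since [differentiable]
   asks for a K-linear Frechet differential, it is then complex
   differentiability.
   Germs are handled through representatives: total functions on K^n that are
   holomorphic near the point, with arbitrary values elsewhere, identified when
   they agree near the point. *)

Section LocalAnalyticGeometry.
Variables (K : numFieldType) (n : nat).

Local Notation Kn := 'rV[K]_n.

Definition holomorphic_near (W : normedModType K) (f : Kn -> W) (p : Kn) : Prop :=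
  \forall z \near p, differentiable f z.

Section AlternatingForms.
Variable q : nat.

(* A q-tuple of vectors of K^n is encoded as the rows of a q x n matrix. *)
Definition multilinear (f : 'M[K]_(q, n) -> K) : Prop :=
  forall (i : 'I_q) (a : K) (A B D : 'M[K]_(q, n)),
    row' i A = row' i D -> row' i B = row' i D ->
    row i D = a *: row i A + row i B ->
    f D = a * f A + f B.

Definition alternating (f : 'M[K]_(q, n) -> K) : Prop :=
  multilinear f /\
  forall (i j : 'I_q) (A : 'M[K]_(q, n)),
    i != j -> row i A = row j A -> f A = 0.

(* Values of a field of q-covectors at a point and on q vectors; the form
   itself is subject to [holomorphic_form]. *)
Definition qform : Type := Kn -> 'M[K]_(q, n) -> K.

Definition holomorphic_form (w : qform) (p : Kn) : Prop :=
  \forall z \near p, alternating (w z) /\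
    forall A : 'M[K]_(q, n), differentiable (fun x => w x A) z.

Definition eq_form_near (w1 w2 : qform) (p : Kn) : Prop :=
  \forall z \near p, forall A : 'M[K]_(q, n), w1 z A = w2 z A.

Definition sing (w : qform) : set Kn :=
  [set z | forall A : 'M[K]_(q, n), w z A = 0].

End AlternatingForms.

(* Interior product, by insertion of v in the first slot; it vanishes on
   functions (q = 0). *)
Definition interior_product (q : nat) (v : Kn -> Kn) : qform q -> qform q.-1 :=
  match q return qform q -> qform q.-1 with
  | 0 => fun _ _ _ => 0
  | q'.+1 => fun w z A => w z (col_mx (v z) A : 'M[K]_(q'.+1, n))
  end.

(* (eta_1 /\ ... /\ eta_q)(v_1, ..., v_q) = det (eta_i(v_j)) *)
Definition wedge1 (q : nat) (eta : 'I_q -> qform 1) : qform q :=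
  fun z A => \det (\matrix_(i < q, j < q) eta i z (row j A)).

Definition locally_decomposable (q : nat) (w : qform q) (p : Kn) : Prop :=
  exists eta : 'I_q -> qform 1,
    (forall i, holomorphic_form (eta i) p) /\ eq_form_near w (wedge1 eta) p.

(* Near p, the set A contains a complex submanifold of codimension d through p,
   the zero set of a holomorphic submersion g to K^d. *)
Definition contains_submanifold (A : set Kn) (d : nat) (p : Kn) : Prop :=
  exists g : Kn -> 'rV[K]_d,
    [/\ holomorphic_near g p, g p = 0, \rank ('J g p) = d &
        \forall z \near p, g z = 0 -> A z].

(* The germ of A at p has codimension at least c: every complex submanifold
   contained in A, close enough to p, has codimension at least c.  For an
   analytic set this is the usual codimension (n minus the maximal dimension of
   regular points of A arbitrarily close to p); it is +oo for an empty germ. *)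
Definition codim_ge (A : set Kn) (c : nat) (p : Kn) : Prop :=
  \forall x \near p, forall d : nat, contains_submanifold A d x -> (c <= d)%N.

Definition defines_distribution (q : nat) (w : qform q) : Prop :=
  [/\ holomorphic_form w 0, codim_ge (sing w) 2 0 &
      \forall p \near (0 : Kn), ~ sing w p -> locally_decomposable w p].

Definition annihilates (q : nat) (v : Kn -> Kn) (w : qform q) : Prop :=
  eq_form_near (interior_product v w) (fun _ _ => 0) 0.

Definition tangent_field (q : nat) (w : qform q) (v : Kn -> Kn) : Prop :=
  holomorphic_near v 0 /\ annihilates v w.

(* The module of germs at 0 of tangent vector fields has a finite basis
   e_1, ..., e_r over the ring of germs at 0 of holomorphic functions. *)
Definition free_tangent_sheaf (q : nat) (w : qform q) : Prop :=
  exists (r : nat) (e : 'I_r -> Kn -> Kn),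
    [/\ forall i, tangent_field w (e i),
        forall v, tangent_field w v ->
          exists a : 'I_r -> Kn -> K,
            (forall i, holomorphic_near (a i) 0) /\
            \forall z \near (0 : Kn), v z = \sum_(i < r) a i z *: e i z
      & forall a : 'I_r -> Kn -> K,
          (forall i, holomorphic_near (a i) 0) ->
          (\forall z \near (0 : Kn), \sum_(i < r) a i z *: e i z = 0) ->
          forall i, \forall z \near (0 : Kn), a i z = 0].

(* Theta has degree q + 1, so that its interior product has degree q. *)
Definition divides (q : nat) (v : Kn -> Kn) (w : qform q) : Prop :=
  exists Theta : qform q.+1,
    holomorphic_form Theta 0 /\ eq_form_near w (interior_product v Theta) 0.

End LocalAnalyticGeometry.

Arguments qform : clear implicits.

(* Main.v *)
From HB Require Import structures.
Require Import Defs.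
From mathcomp Require Import all_boot all_order all_fingroup all_algebra.
From mathcomp Require Import all_classical all_reals all_analysis.
From mathcomp Require Import ring lra.
Set Implicit Arguments.
Unset Strict Implicit.
Unset Printing Implicit Defensive.
Import Order.TTheory GRing.Theory Num.Theory.
Import numFieldNormedType.Exports.
Local Open Scope classical_set_scope.
Local Open Scope ring_scope.

(** Write q = n - k.  At every point z near 0 the form is decomposable or zero,
    hence of the shape A |-> det (A *m L) for some matrix L depending on z.  So
    for constant vectors u_0, ..., u_q the field
      Y_u = sum_j (-1)^j omega(u_0, .., u_j omitted, .., u_q) u_j
    is tangent to the distribution ([contraction_tangent]: Y_u L is a Laplace
    expansion of a determinant with a repeated column), and if i_X omega = 0
    then Y_(X, u) = omega(u) X ([contract_col_mx]).  Write X = sum_i a_i e_i on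
    the basis of the tangent module.

    Suppose a_i(0) <> 0 for some i.  The e_i-coordinate of Y_u is, by uniqueness
    of coordinates, alternating in u: it is a holomorphic (q + 1)-form Theta_i.
    Comparing the e_i-coordinates of both sides of Y_(X, u) = omega(u) X gives
    i_X Theta_i = a_i omega, and a_i is a unit: X divides omega
    ([divides_unit_coord]).

    Suppose that all the a_i vanish at 0.  Then DX(0) = sum_i da_i(0) e_i(0), so
    the e_i(0) span at least k dimensions ([rank_jacobian_vanishing]).  Complete
    them by q constant vectors U to a spanning family, which still spans at
    nearby points.  As the e_i annihilate omega, omega(z) = 0 as soon as
    omega(z)(U) = 0 ([det_form_eq0]): near 0 the singular set is the zero set of
    a single holomorphic function vanishing at 0.  Such a set has codimension at
    most 1 ([zeros_codim_le1]), a contradiction.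

    For this last point let f be holomorphic near 0 with f(0) = 0, not
    identically zero near 0.  Some derivative of f along some direction e does
    not vanish at 0 ([flat_eq0]), so the zeros of f near 0 have bounded order
    along e.  Let p be a zero of minimal order m, and g = D_e^(m-1) f.  By
    minimality g vanishes at all zeros of f near p, and D_e g(p) <> 0, so that
    g = 0 is a smooth hypersurface meeting each line parallel to e at most once
    near p.  Zeros of f on such lines persist when the line moves, by the minimum
    modulus principle; hence g = 0 is contained in f = 0 near p
    ([zeros_persist]).

    The function theory is derived from complex differentiability alone: the
    theorem of Goursat on rectangles ([goursat]), Cauchy estimates on squares
    ([cauchy_deriv_bound], [cauchy_value_bound]), and from these the
    differentiability of derivatives ([differentiable_derive]).  Squares are used
    instead of circles because all integrals are then over segments parallel to
    the axes, and 2 i pi appears as the integral of dz / z, bounded below by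
    [nrm_winding_const]. *)

(** * Complex numbers and norms with real values *)

(** The complex numbers kept folded as a numFieldType, so that their norm and
    topology are found from this structure rather than searched on R[i]. *)
Definition Cx (R : realType) : numFieldType := R[i]%C.

Section ComplexNumbers.
Variable R : realType.
Local Notation C := (Cx R).

Definition cre (z : C) : R := complex.Re z.
Definition cim (z : C) : R := complex.Im z.
Definition cplx (x y : R) : C := Complex x y.
Definition imagu : C := cplx 0 1.
Definition ofR (x : R) : C := cplx x 0.

Lemma cplx_eta (z : C) : z = cplx (cre z) (cim z). Proof. by case: z. Qed.
Lemma cplx_ext (z w : C) : cre z = cre w -> cim z = cim w -> z = w.
Proof. by case: z w => [a b] [c d]; rewrite /cre /cim /= => -> ->. Qed.
Lemma cre0 : cre 0 = 0. Proof. by []. Qed.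
Lemma cim0 : cim 0 = 0. Proof. by []. Qed.
Lemma cre1 : cre 1 = 1. Proof. by []. Qed.
Lemma cim1 : cim 1 = 0. Proof. by []. Qed.
Lemma cre_ofR x : cre (ofR x) = x. Proof. by []. Qed.
Lemma cim_ofR x : cim (ofR x) = 0. Proof. by []. Qed.
Lemma cre_imagu : cre imagu = 0. Proof. by []. Qed.
Lemma cim_imagu : cim imagu = 1. Proof. by []. Qed.
Lemma cre_cplx x y : cre (cplx x y) = x. Proof. by []. Qed.
Lemma cim_cplx x y : cim (cplx x y) = y. Proof. by []. Qed.
Lemma creD z w : cre (z + w) = cre z + cre w. Proof. by case: z w => [a b] [c d]. Qed.
Lemma cimD z w : cim (z + w) = cim z + cim w. Proof. by case: z w => [a b] [c d]. Qed.
Lemma creN z : cre (- z) = - cre z. Proof. by case: z. Qed.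
Lemma cimN z : cim (- z) = - cim z. Proof. by case: z. Qed.
Lemma creB z w : cre (z - w) = cre z - cre w. Proof. by rewrite creD creN. Qed.
Lemma cimB z w : cim (z - w) = cim z - cim w. Proof. by rewrite cimD cimN. Qed.
Lemma creM z w : cre (z * w) = cre z * cre w - cim z * cim w.
Proof. by case: z w => [a b] [c d]. Qed.
Lemma cimM z w : cim (z * w) = cre z * cim w + cim z * cre w.
Proof. by case: z w => [a b] [c d]. Qed.
Definition creimE := (cre0, cim0, cre1, cim1, cre_ofR, cim_ofR, cre_imagu, cim_imagu, cre_cplx,
  cim_cplx, creB, cimB, creD, cimD, creN, cimN, creM, cimM).

Lemma cplxE x y : cplx x y = ofR x + imagu * ofR y.
Proof. by apply: cplx_ext; rewrite !creimE; ring. Qed.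
Lemma ofRD x y : ofR (x + y) = ofR x + ofR y.
Proof. by apply: cplx_ext; rewrite !creimE; ring. Qed.
Lemma ofRN x : ofR (- x) = - ofR x.
Proof. by apply: cplx_ext; rewrite !creimE; ring. Qed.
Lemma ofRB x y : ofR (x - y) = ofR x - ofR y. Proof. by rewrite ofRD ofRN. Qed.
Lemma ofRM x y : ofR (x * y) = ofR x * ofR y.
Proof. by apply: cplx_ext; rewrite !creimE; ring. Qed.
Lemma ofR0 : ofR 0 = 0. Proof. by []. Qed.
Lemma ofR1 : ofR 1 = 1. Proof. by []. Qed.
Lemma ler_ofR x y : (ofR x <= ofR y) = (x <= y). Proof. exact: lecR. Qed.
Lemma ltr_ofR x y : (ofR x < ofR y) = (x < y). Proof. exact: ltcR. Qed.
Lemma ofR_eq0 x : (ofR x == 0) = (x == 0).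
Proof. by apply/eqP/eqP => [/(congr1 cre)|->]. Qed.
Lemma imagu_sqr : imagu * imagu = -1.
Proof. by apply: cplx_ext; rewrite !creimE; ring. Qed.
Lemma lt0_ofR (e : C) : 0 < e -> exists2 d : R, 0 < d & e = ofR d.
Proof.
case: e => a b; rewrite ltcE /= => /andP[/eqP-> a0].
by exists a.
Qed.

(** Norms over the complex numbers are themselves complex numbers; estimates are
    made on this real value. *)
Definition nrm (V : normedModType C) (v : V) : R := cre `|v|.
Lemma nrmE (V : normedModType C) (v : V) : `|v| = ofR (nrm v).
Proof.
apply: cplx_ext; rewrite // cim_ofR.
have : 0 <= `|v| by exact: normr_ge0.
by case: (`|v|) => a b; rewrite lecE /= => /andP[/eqP].
Qed.

Section Norm.
Variable V : normedModType C.
Implicit Types v w : V.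
Lemma nrm_lt v (r : R) : (nrm v < r) = (`|v| < ofR r).
Proof. by rewrite nrmE ltr_ofR. Qed.
Lemma nrm_ge0 v : 0 <= nrm v.
Proof. by rewrite -ler_ofR -nrmE normr_ge0. Qed.
Lemma nrm0 : nrm (0 : V) = 0. Proof. by rewrite /nrm normr0. Qed.
Lemma nrmD v w : nrm (v + w) <= nrm v + nrm w.
Proof. by rewrite -ler_ofR ofRD -!nrmE ler_normD. Qed.
Lemma nrmN v : nrm (- v) = nrm v. Proof. by rewrite /nrm normrN. Qed.
Lemma nrmB v w : nrm (v - w) = nrm (w - v). Proof. by rewrite -nrmN opprB. Qed.
Lemma nrm_eq0 v : (nrm v == 0) = (v == 0).
Proof. by rewrite -ofR_eq0 -nrmE normr_eq0. Qed.
Lemma nrm_gt0 v : (0 < nrm v) = (v != 0).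
Proof. by rewrite lt0r nrm_eq0 nrm_ge0 andbT. Qed.
Lemma nrmZ (a : C) v : nrm (a *: v) = nrm a * nrm v.
Proof.
apply: (can_inj (g := cre) (f := ofR)); first exact: cre_ofR.
by rewrite ofRM -!nrmE normrZ.
Qed.
End Norm.

Lemma nrmM (z w : C) : nrm (z * w) = nrm z * nrm w.
Proof. exact: (nrmZ z (w : C)). Qed.
Lemma nrm1 : nrm (1 : C) = 1. Proof. by rewrite /nrm normr1. Qed.
Lemma nrmV (z : C) : nrm z^-1 = (nrm z)^-1.
Proof.
have [->|z0] := eqVneq z 0; first by rewrite invr0 nrm0 invr0.
apply: (mulfI (x := nrm z)); first by rewrite nrm_eq0.
by rewrite -nrmM !divff ?nrm1 // nrm_eq0.
Qed.
Lemma nrmX (z : C) m : nrm (z ^+ m) = nrm z ^+ m.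
Proof. by elim: m => [|m IH]; rewrite ?expr0 ?nrm1 // !exprS nrmM IH. Qed.
Lemma nrm_ofR x : nrm (ofR x) = `|x|.
Proof.
rewrite /nrm; have [x0|x0] := lerP 0 x.
  by have /ger0_norm -> : 0 <= ofR x; rewrite ?ler_ofR // ger0_norm.
by have /ltr0_norm -> : ofR x < 0; rewrite ?ltr_ofR // creN ltr0_norm.
Qed.
Lemma nrm_imagu : nrm imagu = 1.
Proof.
apply/eqP; rewrite -[_ == _](@eqrXn2 _ 2) ?nrm_ge0 //; apply/eqP.
by rewrite -nrmX expr2 imagu_sqr nrmN nrm1 expr1n.
Qed.
Lemma nrm_sqr (z : C) : nrm z ^+ 2 = cre z ^+ 2 + cim z ^+ 2.
Proof.
have : `|z| ^+ 2 = ofR (cre z ^+ 2 + cim z ^+ 2) by exact: esym (add_Re2_Im2 z).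
by rewrite nrmE expr2 -ofRM => /(congr1 cre); rewrite !cre_ofR -expr2.
Qed.
Lemma cre_le_nrm (z : C) : `|cre z| <= nrm z.
Proof.
by rewrite -(@ler_pXn2r _ 2) ?nnegrE ?nrm_ge0 // nrm_sqr real_normK ?num_real // lerDl sqr_ge0.
Qed.
Lemma cim_le_nrm (z : C) : `|cim z| <= nrm z.
Proof.
by rewrite -(@ler_pXn2r _ 2) ?nnegrE ?nrm_ge0 // nrm_sqr real_normK ?num_real // lerDr sqr_ge0.
Qed.
Lemma nrm_le_reim (z : C) : nrm z <= `|cre z| + `|cim z|.
Proof.
rewrite [X in nrm X]cplx_eta cplxE (le_trans (nrmD _ _)) //.
by rewrite nrmM !nrm_ofR nrm_imagu mul1r.
Qed.
End ComplexNumbers.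

(** * Integrals over segments and rectangles *)

Section Limits.
Variable R : realType.
Local Notation C := (Cx R).

Lemma nbhs_nrmP (V : normedModType C) (v : V) (P : V -> Prop) :
  (\forall w \near v, P w) <->
  exists2 d : R, 0 < d & forall h, nrm h < d -> P (v + h).
Proof.
split.
  move=> /(@nbhs_ballP C V)[e /= /lt0_ofR[d d0 ->] H]; exists d => // h hd; apply: H.
  by rewrite -ball_normE /= opprD addrA subrr sub0r normrN -nrm_lt.
move=> [d d0 H]; apply/(@nbhs_ballP C V); exists (ofR d); first by rewrite /= ltr_ofR.
move=> w; rewrite -ball_normE /= -nrm_lt => h.
by rewrite -(subrK v w) addrC; apply: H; rewrite nrmB.
Qed.

Lemma continuous_nrmP (V W : normedModType C) (f : V -> W) v :
  {for v, continuous f} <->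
  forall e : R, 0 < e -> exists2 d : R, 0 < d & forall h, nrm h < d -> nrm (f (v + h) - f v) < e.
Proof.
split.
  move=> /cvgrPdist_lt H e e0; apply/(nbhs_nrmP v (fun w => nrm (f w - f v) < e)).
  have := H (ofR e); rewrite ltr_ofR => /(_ e0); apply: filterS => w.
  by rewrite nrmB nrm_lt.
move=> H; apply/cvgrPdist_lt => _ /lt0_ofR[e e0 ->].
have /(nbhs_nrmP v (fun w => nrm (f w - f v) < e)) := H _ e0.
by apply: filterS => w; rewrite nrmB nrm_lt.
Qed.

Lemma continuous_realP (W : normedModType C) (F : R -> W) t :
  {for t, continuous F} <->
  forall e : R, 0 < e -> exists2 d : R, 0 < d & forall s, `|s - t| < d -> nrm (F s - F t) < e.
Proof.
split.
  move=> /cvgrPdist_lt H e e0.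
  have := H (ofR e); rewrite ltr_ofR => /(_ e0) /nbhs_ballP[d d0 Hd]; exists d => // s st.
  rewrite nrmB nrm_lt; apply: Hd.
by rewrite /ball /= distrC.
move=> H; apply/cvgrPdist_lt => _ /lt0_ofR[e e0 ->].
have [d d0 Hd] := H _ e0; apply/nbhs_ballP; exists d => //= s.
by rewrite /ball /= distrC => /Hd; rewrite nrmB nrm_lt.
Qed.

Lemma continuous_cre (F : R -> C) t : {for t, continuous F} ->
  {for t, continuous (fun x => cre (F x))}.
Proof.
move=> /continuous_realP H; apply/cvgrPdist_lt => e e0.
have [d d0 Hd] := H _ e0; apply/nbhs_ballP; exists d => //= s.
rewrite /ball /= distrC => /Hd; apply: le_lt_trans.
by rewrite distrC -creB cre_le_nrm.
Qed.

Lemma continuous_cim (F : R -> C) t : {for t, continuous F} ->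
  {for t, continuous (fun x => cim (F x))}.
Proof.
move=> /continuous_realP H; apply/cvgrPdist_lt => e e0.
have [d d0 Hd] := H _ e0; apply/nbhs_ballP; exists d => //= s.
rewrite /ball /= distrC => /Hd; apply: le_lt_trans.
by rewrite distrC -cimB cim_le_nrm.
Qed.
End Limits.

Section Integral.
Variable R : realType.
Local Notation C := (Cx R).
Local Notation mu := (@lebesgue_measure R).

Definition cont_on {T : topologicalType} (F : R -> T) (a b : R) :=
  forall t, a <= t <= b -> {for t, continuous F}.

Definition real_int (a b : R) (f : R -> R) : R := \int[mu]_(x in `[a, b]%classic) f x.

(** The integral over [a, b] of a complex-valued function, by real and imaginary
    parts. *)
Definition segment_int (a b : R) (F : R -> C) : C :=
  cplx (real_int a b (fun x => cre (F x))) (real_int a b (fun x => cim (F x))).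

Lemma cont_on_integrable (f : R -> R) a b : cont_on f a b ->
  mu.-integrable `[a, b]%classic (EFin \o f).
Proof.
move=> cf; apply: continuous_compact_integrable; first exact: segment_compact.
apply: continuous_in_subspaceT => x; rewrite inE /= in_itv /= => xab; exact: cf.
Qed.

Lemma cont_on_cre (F : R -> C) a b : cont_on F a b -> cont_on (fun x => cre (F x)) a b.
Proof. by move=> cF t /cF; exact: continuous_cre. Qed.
Lemma cont_on_cim (F : R -> C) a b : cont_on F a b -> cont_on (fun x => cim (F x)) a b.
Proof. by move=> cF t /cF; exact: continuous_cim. Qed.

Lemma real_int_cst a b (k : R) : a <= b -> real_int a b (fun=> k) = k * (b - a).
Proof.
move=> ab; rewrite /real_int Rintegral_cst //=; congr (_ * _).
rewrite lebesgue_measure_itv /= lte_fin.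
case: ltP => [|ba] //=; have -> : a = b by apply/eqP; rewrite eq_le ab ba.
by rewrite subrr.
Qed.

Lemma real_int_split a c b (f : R -> R) : a <= c -> c <= b -> cont_on f a b ->
  real_int a b f = real_int a c f + real_int c b f.
Proof.
move=> ac cb cf; apply/eqP; rewrite addrC -subr_eq; apply/eqP.
have If := cont_on_integrable cf.
rewrite /real_int Rintegral_itvB // ?bnd_simp //.
apply: Rintegral_itv_obnd_cbnd; apply: integrableS If => //=.
by apply: subset_itvr; rewrite bnd_simp.
Qed.

Lemma real_intD a b (f g : R -> R) : cont_on f a b -> cont_on g a b ->
  real_int a b (fun x => f x + g x) = real_int a b f + real_int a b g.
Proof.
by move=> cf cg; rewrite /real_int RintegralD //; exact: cont_on_integrable.
Qed.
Lemma real_intZ a b k (f : R -> R) : cont_on f a b -> real_int a b (fun x => k * f x) = k * real_int a b f.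
Proof.
by move=> cf; rewrite /real_int RintegralZl //; exact: cont_on_integrable.
Qed.
Lemma le_real_int a b (f g : R -> R) : cont_on f a b -> cont_on g a b ->
  (forall x, a <= x <= b -> f x <= g x) -> real_int a b f <= real_int a b g.
Proof.
move=> cf cg fg; apply: le_Rintegral => //; try exact: cont_on_integrable.
Qed.

Lemma real_int_bound a b (f : R -> R) M : a <= b -> cont_on f a b ->
  (forall x, a <= x <= b -> `|f x| <= M) -> `|real_int a b f| <= M * (b - a).
Proof.
move=> ab cf fM; rewrite ler_norml -mulNr -!(real_int_cst _ ab).
have cc (k : R) : cont_on (fun=> k) a b by move=> t _; exact: cvg_cst.
by apply/andP; split; apply: le_real_int => // x /fM; rewrite ler_norml => /andP[].
Qed.

Lemma real_int_id a b : a <= b -> real_int a b id = (b ^+ 2 - a ^+ 2) / 2.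
Proof.
rewrite le_eqVlt => /predU1P[->|ab].
  by rewrite subrr mul0r /real_int set_itv1 Rintegral_set1.
pose F := 2^-1 \*: ((id : R -> R) * id).
have dF (x : R) : is_derive x 1 F x.
  by apply: is_derive_eq; rewrite /GRing.scale /=; field.
have cF (x : R) : {for x, continuous F}.
  by apply: differentiable_continuous; apply/derivable1_diffP; case: (dF x).
rewrite /real_int /Rintegral.
rewrite (@continuous_FTC2 _ id F) //=.
- have FE (y : R) : F y = y ^+ 2 / 2 by rewrite expr2 [RHS]mulrC.
  by rewrite !FE; field.
- by apply: continuous_subspaceT => x; exact: cvg_id.
- split => [x _||]; first by case: (dF x).
  + by apply: cvg_at_right_filter; exact: cF.
  + by apply: cvg_at_left_filter; exact: cF.
- by move=> x _; rewrite derive1E; case: (dF x).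
Qed.

Lemma segment_int_split a c b F : a <= c -> c <= b -> cont_on (F : R -> C) a b ->
  segment_int a b F = segment_int a c F + segment_int c b F.
Proof.
move=> ac cb cF; rewrite /segment_int (real_int_split ac cb (cont_on_cre cF)).
by rewrite (real_int_split ac cb (cont_on_cim cF)).
Qed.

Lemma segment_intD a b (F G : R -> C) : cont_on (F : R -> C) a b -> cont_on G a b ->
  segment_int a b (fun x => F x + G x) = segment_int a b F + segment_int a b G.
Proof.
move=> cF cG; apply: cplx_ext; rewrite !creimE.
  rewrite -real_intD; [|exact: cont_on_cre..].
  by congr real_int; apply/funext => x; rewrite !creimE.
rewrite -real_intD; [|exact: cont_on_cim..].
by congr real_int; apply/funext => x; rewrite !creimE.
Qed.

Lemma continuous_cstM (k : R) (f : R -> R) t : {for t, continuous f} ->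
  {for t, continuous (fun x => k * f x)}.
Proof. by move=> cf; apply: cvgM => //; exact: cvg_cst. Qed.

Lemma segment_intZ a b c F : cont_on F a b -> segment_int a b (fun x => c * (F : R -> C) x) = c * segment_int a b F.
Proof.
move=> cF; have cR := cont_on_cre cF; have cI := cont_on_cim cF.
have cZ (k : R) f : cont_on f a b -> cont_on (fun x => k * f x) a b.
  by move=> cf t /cf; exact: continuous_cstM.
apply: cplx_ext.
  transitivity (real_int a b (fun x => cre c * cre (F x)) + real_int a b (fun x => - cim c * cim (F x))).
    rewrite -real_intD; [|exact: cZ..].
    by congr real_int; apply/funext => x; rewrite !creimE mulNr.
  by rewrite !real_intZ // !creimE mulNr.
transitivity (real_int a b (fun x => cre c * cim (F x)) + real_int a b (fun x => cim c * cre (F x))).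
  rewrite -real_intD; [|exact: cZ..].
  by congr real_int; apply/funext => x; rewrite !creimE.
by rewrite !real_intZ // !creimE.
Qed.

(** The factor 2 comes from bounding real and imaginary parts separately. *)
Lemma segment_int_bound a b (F : R -> C) M : a <= b -> cont_on (F : R -> C) a b ->
  (forall x, a <= x <= b -> nrm (F x) <= M) -> nrm (segment_int a b F) <= 2 * M * (b - a).
Proof.
move=> ab cF FM; apply: le_trans (nrm_le_reim _) _.
rewrite -mulrA mulr_natl mulr2n; apply: lerD; apply: real_int_bound => //.
- exact: cont_on_cre.
- by move=> x /FM; apply: le_trans; exact: cre_le_nrm.
- exact: cont_on_cim.
- by move=> x /FM; apply: le_trans; exact: cim_le_nrm.
Qed.

Lemma segment_int_cst a b c : a <= b -> segment_int a b (fun=> c) = c * ofR (b - a).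
Proof.
move=> ab; apply: cplx_ext; rewrite !creimE !real_int_cst //; ring.
Qed.

Lemma segment_int_id a b : a <= b -> segment_int a b (fun t => ofR t) = ofR ((b ^+ 2 - a ^+ 2) / 2).
Proof.
move=> ab; apply: cplx_ext; rewrite !creimE; last by rewrite real_int_cst // mul0r.
by rewrite -real_int_id.
Qed.

Lemma eq_segment_int a b (F G : R -> C) : (forall x, a <= x <= b -> F x = G x) -> segment_int a b F = segment_int a b G.
Proof.
move=> FG; apply: cplx_ext; rewrite !creimE; apply: eq_Rintegral => x;
  by rewrite inE /= in_itv /= => /FG ->.
Qed.
End Integral.

Section Differentiability.
Variable R : realType.
Local Notation C := (Cx R).
Variables V W : normedModType C.

Lemma diff_nrm (f : V -> W) v : differentiable f v ->
  forall e : R, 0 < e -> exists2 d : R, 0 < d & forall h, nrm h < d ->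
    nrm (f (v + h) - f v - 'd f v h) <= e * nrm h.
Proof.
move=> /diff_locallyP[_ /eqaddoP H] e e0.
have := H (ofR e); rewrite ltr_ofR => /(_ e0) /nbhs_nrmP[d d0 Hd]; exists d => // h hd.
have := Hd h hd; rewrite add0r !fctE /= !nrmE -ofRM ler_ofR.
by rewrite opprD addrA [h + v]addrC.
Qed.

Lemma nrm_diff (f : V -> W) v (A : {linear V -> W}) : continuous A ->
  (forall e : R, 0 < e -> exists2 d : R, 0 < d & forall h, nrm h < d ->
    nrm (f (v + h) - f v - A h) <= e * nrm h) ->
  differentiable f v /\ 'd f v = A :> (V -> W).
Proof.
move=> cA H.
have oA : f \o shift v = cst (f v) + A +o_ 0 id.
  apply/eqaddoP => _ /lt0_ofR[e e0 ->]; have [d d0 Hd] := H e e0.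
  apply/nbhs_nrmP; exists d => // h hd; rewrite add0r !fctE /= !nrmE -ofRM ler_ofR.
  by rewrite opprD addrA [h + v]addrC; exact: Hd.
have dE := diff_unique cA oA; split => //.
by apply/diff_locallyP; rewrite dE.
Qed.
End Differentiability.

Section Rectangles.
Variable R : realType.
Local Notation C := (Cx R).
Implicit Types (F G : C -> C) (x y : R) (z : C).

(** The integral of F dz over the positively oriented boundary of
    [x1, x2] x [y1, y2]. *)
Definition rect_int F x1 x2 y1 y2 : C :=
  segment_int x1 x2 (fun x => F (cplx x y1)) + imagu R * segment_int y1 y2 (fun y => F (cplx x2 y))
  - segment_int x1 x2 (fun x => F (cplx x y2)) - imagu R * segment_int y1 y2 (fun y => F (cplx x1 y)).

Definition in_rect x1 x2 y1 y2 z := (x1 <= cre z <= x2) && (y1 <= cim z <= y2).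
Definition on_rect x1 x2 y1 y2 z := in_rect x1 x2 y1 y2 z &&
  [|| cre z == x1, cre z == x2, cim z == y1 | cim z == y2].

Definition cont_at F z := {for z, continuous F}.

Lemma cont_hor F a b y : (forall x, a <= x <= b -> cont_at F (cplx x y)) ->
  cont_on (fun x => F (cplx x y)) a b.
Proof.
move=> H x /H /continuous_nrmP cF; apply/continuous_realP => e /cF[d d0 Hd].
exists d => // s sx; have -> : cplx s y = cplx x y + ofR (s - x).
  by apply: cplx_ext; rewrite !creimE ?addr0 // addrC subrK.
by apply: Hd; rewrite nrm_ofR.
Qed.

Lemma cont_ver F a b x : (forall y, a <= y <= b -> cont_at F (cplx x y)) ->
  cont_on (fun y => F (cplx x y)) a b.
Proof.
move=> H y /H /continuous_nrmP cF; apply/continuous_realP => e /cF[d d0 Hd].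
exists d => // s sy; have -> : cplx x s = cplx x y + imagu R * ofR (s - y).
  by apply: cplx_ext; rewrite !creimE; ring.
by apply: Hd; rewrite nrmM nrm_imagu mul1r nrm_ofR.
Qed.

Section Sides.
Variables (P : C -> Prop) (x1 x2 y1 y2 : R).
Hypotheses (x12 : x1 <= x2) (y12 : y1 <= y2).
Hypothesis HP : forall z, on_rect x1 x2 y1 y2 z -> P z.
Lemma side_bot x : x1 <= x <= x2 -> P (cplx x y1).
Proof. by move=> xx; apply: HP; rewrite /on_rect /in_rect !creimE xx lexx y12 eqxx !orbT. Qed.
Lemma side_top x : x1 <= x <= x2 -> P (cplx x y2).
Proof. by move=> xx; apply: HP; rewrite /on_rect /in_rect !creimE xx lexx y12 eqxx !orbT. Qed.
Lemma side_left y : y1 <= y <= y2 -> P (cplx x1 y).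
Proof. by move=> yy; apply: HP; rewrite /on_rect /in_rect !creimE yy lexx x12 eqxx. Qed.
Lemma side_right y : y1 <= y <= y2 -> P (cplx x2 y).
Proof. by move=> yy; apply: HP; rewrite /on_rect /in_rect !creimE yy lexx x12 eqxx !orbT. Qed.
End Sides.

Lemma rect_int_splitx F x1 c x2 y1 y2 : x1 <= c -> c <= x2 ->
  (forall x, x1 <= x <= x2 -> cont_at F (cplx x y1)) ->
  (forall x, x1 <= x <= x2 -> cont_at F (cplx x y2)) ->
  rect_int F x1 x2 y1 y2 = rect_int F x1 c y1 y2 + rect_int F c x2 y1 y2.
Proof.
move=> xc cx /cont_hor c1 /cont_hor c2.
rewrite /rect_int (segment_int_split xc cx c1) (segment_int_split xc cx c2); ring.
Qed.

Lemma rect_int_splity F x1 x2 y1 c y2 : y1 <= c -> c <= y2 ->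
  (forall y, y1 <= y <= y2 -> cont_at F (cplx x1 y)) ->
  (forall y, y1 <= y <= y2 -> cont_at F (cplx x2 y)) ->
  rect_int F x1 x2 y1 y2 = rect_int F x1 x2 y1 c + rect_int F x1 x2 c y2.
Proof.
move=> yc cy /cont_ver c1 /cont_ver c2.
rewrite /rect_int (segment_int_split yc cy c1) (segment_int_split yc cy c2); ring.
Qed.

Section OneRectangle.
Variables x1 x2 y1 y2 : R.
Hypotheses (x12 : x1 <= x2) (y12 : y1 <= y2).
Let bd := on_rect x1 x2 y1 y2.

Lemma cont_sides F : (forall z, bd z -> cont_at F z) ->
  [/\ cont_on (fun x => F (cplx x y1)) x1 x2, cont_on (fun x => F (cplx x y2)) x1 x2,
      cont_on (fun y => F (cplx x1 y)) y1 y2 & cont_on (fun y => F (cplx x2 y)) y1 y2].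
Proof.
move=> H; split; [apply: cont_hor|apply: cont_hor|apply: cont_ver|apply: cont_ver].
- exact: side_bot H. - exact: side_top H. - exact: side_left H. - exact: side_right H.
Qed.

Lemma rect_intD F G : (forall z, bd z -> cont_at F z) -> (forall z, bd z -> cont_at G z) ->
  rect_int (fun z => F z + G z) x1 x2 y1 y2 = rect_int F x1 x2 y1 y2 + rect_int G x1 x2 y1 y2.
Proof.
move=> /cont_sides[? ? ? ?] /cont_sides[? ? ? ?]; rewrite /rect_int !segment_intD //; ring.
Qed.

Lemma rect_intZ c F : (forall z, bd z -> cont_at F z) ->
  rect_int (fun z => c * F z) x1 x2 y1 y2 = c * rect_int F x1 x2 y1 y2.
Proof. by move=> /cont_sides[? ? ? ?]; rewrite /rect_int !segment_intZ //; ring. Qed.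

Lemma eq_rect_int F G : (forall z, bd z -> F z = G z) -> rect_int F x1 x2 y1 y2 = rect_int G x1 x2 y1 y2.
Proof.
move=> FG; rewrite /rect_int; congr (_ + _ * _ - _ - _ * _); apply: eq_segment_int.
- exact: side_bot FG. - exact: side_right FG. - exact: side_top FG. - exact: side_left FG.
Qed.

Lemma rect_int_bound F M : (forall z, bd z -> cont_at F z) -> (forall z, bd z -> nrm (F z) <= M) ->
  nrm (rect_int F x1 x2 y1 y2) <= 4 * M * ((x2 - x1) + (y2 - y1)).
Proof.
move=> /cont_sides[cb ct cl cr] FM.
have b1 := segment_int_bound x12 cb (side_bot y12 FM).
have b2 := segment_int_bound y12 cr (side_right x12 FM).
have b3 := segment_int_bound x12 ct (side_top y12 FM).
have b4 := segment_int_bound y12 cl (side_left x12 FM).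
rewrite /rect_int; apply: le_trans (nrmD _ _) _; rewrite nrmN nrmM nrm_imagu mul1r.
apply: (le_trans (lerD (nrmD _ _) b4)); rewrite nrmN.
apply: (le_trans (lerD (lerD (nrmD _ _) b3) (lexx _))); rewrite nrmM nrm_imagu mul1r.
apply: (le_trans (lerD (lerD (lerD b1 b2) (lexx _)) (lexx _))).
lra.
Qed.

(** The case of Goursat's theorem from which the general one follows by local
    affine approximation. *)
Lemma rect_int_affine a b : rect_int (fun z => a + b * z) x1 x2 y1 y2 = 0.
Proof.
have cc (T : topologicalType) (f : R -> T) (u v : R) : continuous f -> cont_on f u v.
  by move=> cf t _; exact: cf.
have cid (u v : R) : cont_on (fun t => ofR t : C) u v.
  apply: cc => t; apply/continuous_realP => e e0; exists e => // s.
  by rewrite -ofRB nrm_ofR.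
have cst (k : C) (u v : R) : cont_on (fun=> k) u v by move=> t _; exact: cvg_cst.
have Z (k : C) (u v : R) : cont_on (fun t => k * ofR t) u v.
  apply: cc => t; apply/continuous_realP => e e0.
  exists (e / (nrm k + 1)); first by rewrite divr_gt0 // ltr_wpDl // nrm_ge0.
  move=> s; rewrite -mulrBr -ofRB nrmM nrm_ofR => h.
  apply: le_lt_trans (_ : (nrm k + 1) * `|s - t| < e); first by rewrite ler_wpM2r // lerDl.
  by rewrite -ltr_pdivlMl ?ltr_wpDl ?nrm_ge0 // mulrC.
have H (y : R) : segment_int x1 x2 (fun x => a + b * cplx x y) =
    (a + b * (imagu R * ofR y)) * ofR (x2 - x1) + b * ofR ((x2 ^+ 2 - x1 ^+ 2) / 2).
  rewrite -segment_int_id // -(segment_intZ b (cid _ _)) -segment_int_cst // -(segment_intD (cst _ _ _) (Z _ _ _)).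
  by apply: eq_segment_int => x _; rewrite cplxE; ring.
have V (x : R) : segment_int y1 y2 (fun y => a + b * cplx x y) =
    (a + b * ofR x) * ofR (y2 - y1) + b * imagu R * ofR ((y2 ^+ 2 - y1 ^+ 2) / 2).
  rewrite -segment_int_id // -(segment_intZ (b * imagu R) (cid _ _)) -segment_int_cst // -(segment_intD (cst _ _ _) (Z _ _ _)).
  by apply: eq_segment_int => y _; rewrite cplxE; ring.
by rewrite /rect_int !H !V !ofRB; ring.
Qed.
End OneRectangle.
End Rectangles.

(** * Goursat's theorem *)

Lemma eq_ler (R : realType) (x y : R) : x = y -> x <= y.
Proof. by move=> ->. Qed.

Lemma quarter_le (R : realType) (t0 t1 t2 t3 t4 : R) : t0 <= t1 + t2 + (t3 + t4) ->
  4 * t1 < t0 -> 4 * t2 < t0 -> 4 * t3 < t0 -> t0 <= 4 * t4.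
Proof. lra. Qed.

Section Goursat.
Variable R : realType.
Local Notation C := (Cx R).
Variables (F : C -> C) (x1 x2 y1 y2 : R).
Hypotheses (x12 : x1 <= x2) (y12 : y1 <= y2).
Hypothesis dF : forall z, in_rect x1 x2 y1 y2 z -> differentiable F z.

Let w n := (x2 - x1) / 2 ^+ n.
Let h n := (y2 - y1) / 2 ^+ n.
Let T n (p : R * R) := rect_int F p.1 (p.1 + w n) p.2 (p.2 + h n).

Let wS n : w n = w n.+1 + w n.+1.
Proof. by rewrite /w exprS; field; rewrite expf_neq0. Qed.
Let hS n : h n = h n.+1 + h n.+1.
Proof. by rewrite /h exprS; field; rewrite expf_neq0. Qed.
Let w_ge0 n : 0 <= w n. Proof. by rewrite /w divr_ge0 ?exprn_ge0 // subr_ge0. Qed.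
Let h_ge0 n : 0 <= h n. Proof. by rewrite /h divr_ge0 ?exprn_ge0 // subr_ge0. Qed.

Let inside n (p : R * R) :=
  [/\ x1 <= p.1, p.1 + w n <= x2, y1 <= p.2 & p.2 + h n <= y2].

Let nested m n (p q : R * R) :=
  [/\ p.1 <= q.1, q.1 + w n <= p.1 + w m, p.2 <= q.2 & q.2 + h n <= p.2 + h m].

Let good n p q := [/\ inside n.+1 q, nested n n.+1 p q & nrm (T n p) <= 4 * nrm (T n.+1 q)].

(** The integral over a rectangle is the sum of the integrals over its four
    quarters, so one of them carries at least a quarter of it. *)
Lemma quarter_exists n p : inside n p -> exists q, good n p q.
Proof.
case: p => a b [/= i1 i2 i3 i4].
have cF x y : x1 <= x <= x2 -> y1 <= y <= y2 -> cont_at F (cplx x y).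
  by move=> xx yy; apply/differentiable_continuous/dF; rewrite /in_rect !creimE xx.
have w0 := w_ge0 n.+1; have h0 := h_ge0 n.+1; have w2 := wS n; have h2 := hS n.
have sub (u v : R) : 0 <= u -> u <= w n.+1 -> 0 <= v -> v <= h n.+1 ->
    inside n.+1 (a + u, b + v) /\ nested n n.+1 (a, b) (a + u, b + v).
  by move=> u0 u1 v0 v1; split; split => /=; lra.
have TE : T n (a, b) = T n.+1 (a, b) + T n.+1 (a, b + h n.+1) +
    (T n.+1 (a + w n.+1, b) + T n.+1 (a + w n.+1, b + h n.+1)).
  have aw : a + w n = a + w n.+1 + w n.+1 by lra.
  have bh : b + h n = b + h n.+1 + h n.+1 by lra.
  rewrite /T /= aw bh (@rect_int_splitx _ _ a (a + w n.+1)); [|lra|lra| |]; last 2 first.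
  - by move=> x /andP[? ?]; apply: cF; apply/andP; split; lra.
  - by move=> x /andP[? ?]; apply: cF; apply/andP; split; lra.
  congr (_ + _).
    rewrite (@rect_int_splity _ _ _ _ b (b + h n.+1)); [|lra|lra| |]; last 2 first.
    - by move=> y /andP[? ?]; apply: cF; apply/andP; split; lra.
    - by move=> y /andP[? ?]; apply: cF; apply/andP; split; lra.
    by [].
  rewrite (@rect_int_splity _ _ _ _ b (b + h n.+1)); [|lra|lra| |]; last 2 first.
  - by move=> y /andP[? ?]; apply: cF; apply/andP; split; lra.
  - by move=> y /andP[? ?]; apply: cF; apply/andP; split; lra.
  by [].
have le4 : nrm (T n (a, b)) <= nrm (T n.+1 (a, b)) + nrm (T n.+1 (a, b + h n.+1)) +
    (nrm (T n.+1 (a + w n.+1, b)) + nrm (T n.+1 (a + w n.+1, b + h n.+1))).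
  by rewrite TE; apply: le_trans (nrmD _ _) _; apply: lerD; exact: nrmD.
have goodI u v : nrm (T n (a, b)) <= 4 * nrm (T n.+1 (a + u, b + v)) ->
    0 <= u -> u <= w n.+1 -> 0 <= v -> v <= h n.+1 -> exists q, good n (a, b) q.
  by move=> Tle u0 u1 v0 v1; have [i j] := sub u v u0 u1 v0 v1; exists (a + u, b + v); split.
have [c1|c1] := lerP (nrm (T n (a, b))) (4 * nrm (T n.+1 (a + 0, b + 0))).
  exact: goodI c1 _ _ _ _.
have [c2|c2] := lerP (nrm (T n (a, b))) (4 * nrm (T n.+1 (a + 0, b + h n.+1))).
  exact: goodI c2 _ _ _ _.
have [c3|c3] := lerP (nrm (T n (a, b))) (4 * nrm (T n.+1 (a + w n.+1, b + 0))).
  exact: goodI c3 _ _ _ _.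
apply: (goodI (w n.+1) (h n.+1)) => //.
rewrite ?(addr0 a) ?(addr0 b) in c1 c2 c3.
exact: quarter_le le4 c1 c2 c3.
Qed.

Let next n p : R * R := xget p [set q | inside n p -> good n p q]%classic.

Let nextP n p : inside n p -> good n p (next n p).
Proof.
move=> ip; rewrite /next; case: xgetP => [q _ H|H]; first exact: H.
by have [q Hq] := quarter_exists ip; case: (H q).
Qed.

Let Fixpoint s n : R * R := if n is m.+1 then next m (s m) else (x1, y1).

Let s_inside n : inside n (s n).
Proof.
elim: n => [|n IH]; last by have [] := nextP IH.
by split => //=; rewrite /w /h expr0 divr1 addrC subrK.
Qed.
Let s_nested m n : (m <= n)%N -> nested m n (s m) (s n).
Proof.
move=> /subnK <-; elim: (n - m)%N => [|d [i1 i2 i3 i4]]; first by rewrite add0n; split.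
have [_ [j1 j2 j3 j4] _] := nextP (s_inside (d + m)).
rewrite addSn /=; split; [exact: le_trans j1|exact: le_trans j2 _|exact: le_trans j3|exact: le_trans j4 _].
Qed.
Let s_int n : nrm (T 0 (x1, y1)) <= 4 ^+ n * nrm (T n (s n)).
Proof.
elim: n => [|n IH]; first by rewrite expr0 mul1r.
apply: le_trans IH _; rewrite exprSr -mulrA ler_wpM2l ?exprn_ge0 //.
by have [] := nextP (s_inside n).
Qed.

Let s1_le m n : (s m).1 <= (s n).1 + w n.
Proof.
have [/s_nested[i _ _ _]|/ltnW/s_nested[_ i _ _]] := leqP m n.
  by apply: le_trans i _; rewrite lerDl.
by apply: le_trans i; rewrite lerDl.
Qed.
Let s2_le m n : (s m).2 <= (s n).2 + h n.
Proof.
have [/s_nested[_ _ i _]|/ltnW/s_nested[_ _ _ i]] := leqP m n.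
  by apply: le_trans i _; rewrite lerDl.
by apply: le_trans i; rewrite lerDl.
Qed.

Let A := sup [set (s n).1 | n in setT]%classic.
Let B := sup [set (s n).2 | n in setT]%classic.

Let A_in n : (s n).1 <= A <= (s n).1 + w n.
Proof.
apply/andP; split.
  apply: sup_upper_bound; last by exists n.
  split; first by exists (s 0).1, 0.
  by exists ((s 0).1 + w 0) => _ [m _ <-]; exact: s1_le.
apply: ge_sup; first by exists (s 0).1, 0.
by move=> _ [m _ <-]; exact: s1_le.
Qed.
Let B_in n : (s n).2 <= B <= (s n).2 + h n.
Proof.
apply/andP; split.
  apply: sup_upper_bound; last by exists n.
  split; first by exists (s 0).2, 0.
  by exists ((s 0).2 + h 0) => _ [m _ <-]; exact: s2_le.
apply: ge_sup; first by exists (s 0).2, 0.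
by move=> _ [m _ <-]; exact: s2_le.
Qed.

(** Repeated quartering gives nested rectangles, of sides divided by 2^n, whose
    boundary integrals are at least 4^-n times the initial one.  At their common
    point F is affine up to e |z - c|, so the integral over the n-th rectangle is
    O(e 4^-n); hence the initial integral is O(e) for every e > 0. *)
Lemma goursat : rect_int F x1 x2 y1 y2 = 0.
Proof.
have Ain : x1 <= A <= x2.
  have [i1 i2 _ _] := s_inside 0; have /andP[j1 j2] := A_in 0.
  by rewrite (le_trans i1 j1) (le_trans j2 i2).
have Bin : y1 <= B <= y2.
  have [_ _ i1 i2] := s_inside 0; have /andP[j1 j2] := B_in 0.
  by rewrite (le_trans i1 j1) (le_trans j2 i2).
pose c : C := cplx A B; have dFc : differentiable F c.
  by apply: dF; rewrite /in_rect !creimE Ain.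
pose L := (x2 - x1) + (y2 - y1).
have L0 : 0 <= L by rewrite addr_ge0 // subr_ge0.
apply/eqP; rewrite -nrm_eq0 eq_le nrm_ge0 andbT.
suff H (e : R) : 0 < e -> nrm (rect_int F x1 x2 y1 y2) <= 4 * (L ^+ 2) * e.
  apply/ler_addgt0Pl => e e0; rewrite addr0.
  have L2 : 0 < 4 * L ^+ 2 + 1 by rewrite ltr_wpDl // mulr_ge0 // sqr_ge0.
  have /le_trans := H (e / (4 * L ^+ 2 + 1)) (divr_gt0 e0 L2); apply.
  rewrite mulrA ler_pdivrMr // mulrC ler_wpM2l ?(ltW e0) // lerDl //.
move=> e0; have [d d0 Hd] := diff_nrm dFc e0.
(* n is such that the n-th rectangle lies where F is affine up to e *)
have [n nd] : exists n : nat, L / 2 ^+ n < d.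
  have [n Hn] : exists n : nat, L / d < n%:R.
    by exists (Num.truncn (L / d)).+1; rewrite truncnS_gt.
  exists n; rewrite ltr_pdivrMr ?exprn_gt0 // mulrC -ltr_pdivrMr //.
  by apply: lt_le_trans Hn _; rewrite -natrX ler_nat ltnW // ltn_expl.
have [i1 i2 i3 i4] := s_inside n.
have /andP[a1 a2] := A_in n; have /andP[b1 b2] := B_in n.
have w0 := w_ge0 n; have h0 := h_ge0 n.
(* G is F minus its affine approximation, which integrates to 0 *)
pose G z := F z - (F c - c * 'd F c (1 : C) + 'd F c (1 : C) * z).
have sub z : in_rect (s n).1 ((s n).1 + w n) (s n).2 ((s n).2 + h n) z ->
    differentiable F z /\ nrm (z - c) <= L / 2 ^+ n.
  move=> /andP[/andP[r1 r2] /andP[r3 r4]]; split.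
    by apply: dF; rewrite /in_rect; apply/andP; split; apply/andP; split; lra.
  apply: le_trans (nrm_le_reim _) _; rewrite !creimE.
  have -> : L / 2 ^+ n = w n + h n by rewrite /L mulrDl.
  by apply: lerD; rewrite ler_norml; apply/andP; split; lra.
have cont_aff (u v : C) z : cont_at (fun t => u + v * t) z.
  apply: differentiable_continuous; apply: differentiableD; first exact: differentiable_cst.
  by apply: (@differentiableM _ _ (cst v) id); [exact: differentiable_cst|exact: ex_diff].
have cFz z : in_rect (s n).1 ((s n).1 + w n) (s n).2 ((s n).2 + h n) z -> cont_at F z.
  by move=> /sub[/differentiable_continuous].
have GE : T n (s n) = rect_int G (s n).1 ((s n).1 + w n) (s n).2 ((s n).2 + h n).
  rewrite /T -[LHS]addr0.
  rewrite -(rect_int_affine (x1 := (s n).1) (x2 := (s n).1 + w n) (y1 := (s n).2)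
    (y2 := (s n).2 + h n) _ _ (- (F c - c * 'd F c (1 : C))) (- 'd F c (1 : C))) ?lerDl //.
  rewrite -rect_intD ?lerDl //; last by move=> z /andP[/cFz].
  by apply: eq_rect_int; rewrite ?lerDl // => z _; rewrite /G; ring.
have Gb z : in_rect (s n).1 ((s n).1 + w n) (s n).2 ((s n).2 + h n) z ->
    nrm (G z) <= e * (L / 2 ^+ n).
  move=> /sub[_ zc]; have := Hd (z - c) (le_lt_trans zc nd).
  rewrite [c + _]addrC subrK.
  have -> : 'd F c (z - c) = (z - c) * 'd F c (1 : C).
    by rewrite -[in LHS](mulr1 (z - c)) -[_ * 1]/(_ *: _) linearZ.
  have -> : F z - F c - (z - c) * 'd F c (1 : C) = G z by rewrite /G; ring.
  by move=> /le_trans; apply; rewrite ler_wpM2l // ltW.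
have cG z : in_rect (s n).1 ((s n).1 + w n) (s n).2 ((s n).2 + h n) z -> cont_at G z.
  move=> /sub[/differentiable_continuous cz _].
  have -> : G = (fun z => F z + (- (F c - c * 'd F c (1 : C)) + - 'd F c (1 : C) * z)).
    by apply/funext => t; rewrite /G; ring.
  exact: (continuousD cz (cont_aff _ _ z)).
have Tb : nrm (T n (s n)) <= 4 * (e * (L / 2 ^+ n)) * (L / 2 ^+ n).
  have -> : L / 2 ^+ n = ((s n).1 + w n - (s n).1) + ((s n).2 + h n - (s n).2).
    by rewrite /L mulrDl /w /h; ring.
  rewrite GE; apply: rect_int_bound; rewrite ?lerDl //; first by move=> z /andP[/cG].
  move=> z /andP[/Gb zb _]; apply: le_trans zb _.
  by rewrite /L mulrDl -/(w n) -/(h n); apply: eq_ler; ring.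
have := s_int n; rewrite {1}/T /= /w /h expr0 !divr1 ![_ + (_ - _)]addrC !subrK.
move=> /le_trans; apply.
apply: le_trans (ler_wpM2l _ Tb) _; first by rewrite exprn_ge0.
have -> : 4 ^+ n = 2 ^+ n * 2 ^+ n :> R by rewrite -exprMn; congr (_ ^+ _); ring.
have n0 : 2 ^+ n != 0 :> R by rewrite expf_neq0.
by apply: eq_ler; field.
Qed.
End Goursat.

(** * Cauchy estimates on squares *)

Section CauchyFormula.
Variable R : realType.
Local Notation C := (Cx R).
Implicit Types (F G : C -> C) (r s M : R) (z : C).

Lemma cont_at_cst (k : C) z : cont_at (fun=> k) z.
Proof. exact: cst_continuous. Qed.
Lemma cont_atD F G z : cont_at F z -> cont_at G z -> cont_at (fun z => F z + G z) z.
Proof. by move=> cF cG; exact: (continuousD cF cG). Qed.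
Lemma cont_atM F G z : cont_at F z -> cont_at G z -> cont_at (fun z => F z * G z) z.
Proof. by move=> cF cG; exact: (continuousM cF cG). Qed.
Lemma cont_atZ (k : C) F z : cont_at F z -> cont_at (fun z => k * F z) z.
Proof. by move=> cF; exact: (@cont_atM (fun=> k) F z (@cont_at_cst k z) cF). Qed.

(** The norm whose spheres are the boundaries of squares. *)
Definition supnorm z : R := Num.max `|cre z| `|cim z|.

Lemma supnorm_le_nrm z : supnorm z <= nrm z.
Proof. by rewrite ge_max cre_le_nrm cim_le_nrm. Qed.
Lemma nrm_le_supnorm z : nrm z <= 2 * supnorm z.
Proof.
apply: le_trans (nrm_le_reim z) _; rewrite mulr_natl mulr2n.
by apply: lerD; rewrite le_max lexx ?orbT.
Qed.
Lemma supnorm_cplx x y : supnorm (cplx x y) = Num.max `|x| `|y|. Proof. by []. Qed.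

Definition square_int F r := rect_int F (- r) r (- r) r.

Lemma on_square_supnorm r z : 0 < r -> on_rect (- r) r (- r) r z -> supnorm z = r.
Proof.
move=> r0 /andP[/andP[]]; rewrite -!ler_norml => xr yr h.
apply/eqP; rewrite eq_le ge_max xr yr /= le_max.
by case/or4P: h => /eqP ->; rewrite ?normrN (gtr0_norm r0) ?lexx ?orbT.
Qed.

(** The region between two concentric squares is a union of four rectangles, on
    each of which Goursat's theorem applies. *)
Lemma square_int_annulus F r s : 0 < r -> r <= s ->
  (forall z, r <= supnorm z <= s -> differentiable F z) -> square_int F s = square_int F r.
Proof.
move=> r0 rs dF.
have dFc x y : - s <= x <= s -> - s <= y <= s -> (r <= `|x|) || (r <= `|y|) ->
    differentiable F (cplx x y).
  rewrite -!ler_norml => xs ys h; apply: dF.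
  by rewrite supnorm_cplx ge_max xs ys le_max h.
have cFc x y : - s <= x <= s -> - s <= y <= s -> (r <= `|x|) || (r <= `|y|) ->
    cont_at F (cplx x y).
  by move=> *; apply/differentiable_continuous/dFc.
have dRect x1 x2 y1 y2 : - s <= x1 -> x2 <= s -> - s <= y1 -> y2 <= s ->
    [|| x2 <= - r, r <= x1, y2 <= - r | r <= y1] ->
    forall z, in_rect x1 x2 y1 y2 z -> differentiable F z.
  move=> h1 h2 h3 h4 h z /andP[/andP[i1 i2] /andP[i3 i4]]; rewrite [z]cplx_eta.
  apply: dFc; [apply/andP; split; lra|apply/andP; split; lra|].
  rewrite !ler_normr; apply/orP; case/or4P: h => h.
  - by left; apply/orP; right; lra.
  - by left; apply/orP; left; lra.
  - by right; apply/orP; right; lra.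
  - by right; apply/orP; left; lra.
have rE : r <= `|r| by rewrite ler_norm.
have sE : r <= `|s| by apply: le_trans rs _; rewrite ler_norm.
rewrite /square_int (@rect_int_splitx _ _ (- s) (- r) s); [|lra|lra| |]; last 2 first.
- by move=> x xs; apply: cFc => //; [apply/andP; split; lra|rewrite normrN sE orbT].
- by move=> x xs; apply: cFc => //; [apply/andP; split; lra|rewrite sE orbT].
rewrite goursat ?add0r; [|lra|lra|]; last first.
  by apply: dRect; rewrite ?lexx ?orbT //; lra.
rewrite (@rect_int_splitx _ _ (- r) r s); [|lra|lra| |]; last 2 first.
- by move=> x /andP[? ?]; apply: cFc; [apply/andP; split; lra|apply/andP; split; lra|rewrite normrN sE orbT].
- by move=> x /andP[? ?]; apply: cFc; [apply/andP; split; lra|apply/andP; split; lra|rewrite sE orbT].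
rewrite (goursat (x1 := r)) ?addr0; [|lra|lra|]; last first.
  by apply: dRect; rewrite ?lexx ?orbT //; lra.
rewrite (@rect_int_splity _ _ _ _ (- s) (- r) s); [|lra|lra| |]; last 2 first.
- by move=> y ys; apply: cFc => //; [apply/andP; split; lra|rewrite normrN rE].
- by move=> y ys; apply: cFc => //; [apply/andP; split; lra|rewrite rE].
rewrite goursat ?add0r; [|lra|lra|]; last first.
  by apply: dRect; rewrite ?lexx ?orbT //; lra.
rewrite (@rect_int_splity _ _ _ _ (- r) r s); [|lra|lra| |]; last 2 first.
- by move=> y /andP[? ?]; apply: cFc; [apply/andP; split; lra|apply/andP; split; lra|rewrite normrN rE].
- by move=> y /andP[? ?]; apply: cFc; [apply/andP; split; lra|apply/andP; split; lra|rewrite rE].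
rewrite (goursat (y1 := r)) ?addr0; [|lra|lra|] => //.
by apply: dRect; rewrite ?lexx ?orbT //; lra.
Qed.

Lemma supnorm_gt0 z : 0 < supnorm z -> z != 0.
Proof. by move=> z0; rewrite -nrm_gt0; apply: lt_le_trans z0 (supnorm_le_nrm z). Qed.

Lemma square_int_bound F r M : 0 < r -> (forall z, supnorm z = r -> cont_at F z) ->
  (forall z, supnorm z = r -> nrm (F z) <= M) -> nrm (square_int F r) <= 16 * M * r.
Proof.
move=> r0 cF FM; have rr : - r <= r by lra.
have -> : 16 * M * r = 4 * M * ((r - - r) + (r - - r)) by ring.
by apply: rect_int_bound => // z /(on_square_supnorm r0); [exact: cF|exact: FM].
Qed.

Lemma differentiable_inv z : z != 0 -> differentiable (fun z : C => z^-1) z.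
Proof. exact: differentiable_Rinv. Qed.

Lemma differentiable_over_sqr F z : z != 0 -> differentiable F z -> differentiable (fun z => F z * z^-1 ^+ 2) z.
Proof.
move=> z0 dF; apply: (@differentiableM _ _ F (fun z => z^-1 ^+ 2)); first exact: dF.
by apply: (@differentiableX _ _ (fun z : C => z^-1) 1); exact: differentiable_inv.
Qed.

(** The number 2 i pi, bounded below by [nrm_winding_const]. *)
Definition winding_const := square_int (fun z => z^-1) 1.

Lemma square_int_inv r : 0 < r -> square_int (fun z => z^-1) r = winding_const.
Proof.
move=> r0; rewrite /winding_const; have [r1|/ltW r1] := leP r 1.
  by apply/esym/(square_int_annulus r0 r1) => z /andP[/(lt_le_trans r0)/supnorm_gt0/differentiable_inv].
by apply: (square_int_annulus ltr01 r1) => z /andP[/(lt_le_trans ltr01)/supnorm_gt0/differentiable_inv].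
Qed.

Lemma cre_inv z : cre z^-1 = cre z / (cre z ^+ 2 + cim z ^+ 2).
Proof. by case: z. Qed.
Lemma cim_inv z : cim z^-1 = - (cim z / (cre z ^+ 2 + cim z ^+ 2)).
Proof. by case: z. Qed.

(** On the sides of the unit square the imaginary part of dz / z is
    dt / (1 + t^2), at least 1/2 dt; the four sides have length 2. *)
Lemma cim_winding_const : 4 <= cim winding_const.
Proof.
have half (f : R -> R) : cont_on f (- 1) 1 -> (forall x, f x = 1 / (1 + x ^+ 2)) ->
    1 <= real_int (- 1) 1 f.
  move=> cf fE.
  apply: le_trans (_ : real_int (- 1) 1 (fun=> 1 / 2 : R) <= _); first by rewrite real_int_cst; lra.
  apply: le_real_int => //; first by move=> t _; exact: cvg_cst.
  move=> x /andP[x1 x2]; rewrite fE; have x0 := sqr_ge0 x.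
  rewrite !div1r lef_pV2 ?posrE; [nra|lra|lra].
have le11 : - 1 <= 1 :> R by lra.
have cI z : on_rect (- 1) 1 (- 1) 1 z -> cont_at (fun z => z^-1) z.
  move=> /(on_square_supnorm ltr01) z1; apply/differentiable_continuous/differentiable_inv/supnorm_gt0.
  by rewrite z1.
have [cb ct cl cr] := cont_sides le11 le11 cI.
have rN (f : R -> R) : cont_on f (- 1) 1 -> cont_on (fun x => - 1 * f x) (-1) 1.
  by move=> cf t /cf; exact: continuous_cstM.
have h1 : 1 <= real_int (- 1) 1 (fun x : R => cim ((cplx x (- 1))^-1)).
  by apply: half; [exact: cont_on_cim|move=> x; rewrite cim_inv !creimE sqrrN expr1n [_ + 1]addrC; ring].
have h2 : 1 <= real_int (- 1) 1 (fun y : R => cre ((cplx 1 y)^-1)).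
  by apply: half; [exact: cont_on_cre|move=> x; rewrite cre_inv !creimE expr1n].
have h3 : 1 <= real_int (- 1) 1 (fun x : R => - 1 * cim ((cplx x 1)^-1)).
  apply: half; first by apply: rN; exact: cont_on_cim.
  by move=> x; rewrite cim_inv !creimE; rewrite expr1n [_ + 1]addrC; ring.
have h4 : 1 <= real_int (- 1) 1 (fun y : R => - 1 * cre ((cplx (- 1) y)^-1)).
  apply: half; first by apply: rN; exact: cont_on_cre.
  by move=> y; rewrite cre_inv !creimE sqrrN expr1n; ring.
rewrite real_intZ in h3; last exact: cont_on_cim.
rewrite real_intZ in h4; last exact: cont_on_cre.
rewrite /winding_const /square_int /rect_int /segment_int !creimE; lra.
Qed.

Lemma nrm_winding_const : 4 <= nrm winding_const.
Proof. by apply: le_trans cim_winding_const _; apply: le_trans (ler_norm _) (cim_le_nrm _). Qed.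

(** The integral does not depend on the size of the square, and tends to 0 when
    the square grows, since the integrand is O(s^-2) on a length O(s). *)
Lemma square_int_inv_sqr r : 0 < r -> square_int (fun z => z^-1 ^+ 2) r = 0.
Proof.
move=> r0; apply/eqP; rewrite -nrm_eq0 eq_le nrm_ge0 andbT.
have d z : 0 < supnorm z -> differentiable (fun z : C => z^-1 ^+ 2) z.
  by move=> /supnorm_gt0 z0; apply: (@differentiableX _ _ (fun z : C => z^-1) 1); exact: differentiable_inv.
apply/ler_addgt0Pl => e e0; rewrite addr0.
pose s := r + 16 / e; have s0 : 0 < s by rewrite addr_gt0 // divr_gt0.
have rs : r <= s by rewrite lerDl divr_ge0 // ltW.
have da z : r <= supnorm z <= s -> differentiable (fun z : C => z^-1 ^+ 2) z.
  by move=> /andP[/(lt_le_trans r0)/d].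
rewrite -(square_int_annulus r0 rs da).
apply: le_trans (square_int_bound s0 (M := s^-1 ^+ 2) _ _) _.
- by move=> z zs; apply/differentiable_continuous/d; rewrite zs.
- move=> z zs; rewrite nrmX nrmV ler_pXn2r ?nnegrE ?invr_ge0 ?nrm_ge0 ?(ltW s0) //.
  have zs' : s <= nrm z by rewrite -zs supnorm_le_nrm.
  by rewrite lef_pV2 ?posrE // (lt_le_trans s0).
have -> : 16 * s^-1 ^+ 2 * s = 16 / s by field; rewrite gt_eqF.
rewrite ler_pdivrMr // /s mulrDr mulrCA divff ?gt_eqF // mulr1 lerDr mulr_ge0 // ltW //.
Qed.

(** The integral on the right does not depend on r.  On a small square,
    F(z) = F(0) + F'(0) z + o(z), where the first term contributes 0, the second
    one the winding integral, and the remainder o(1). *)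
Lemma cauchy_deriv F r : 0 < r -> (forall z, supnorm z <= r -> differentiable F z) ->
  winding_const * 'd F (0 : C) (1 : C) = square_int (fun z => F z * z^-1 ^+ 2) r.
Proof.
move=> r0 dF; apply/eqP; rewrite -subr_eq0 -nrm_eq0 eq_le nrm_ge0 andbT.
apply/ler_addgt0Pl => e e0; rewrite addr0.
have dF0 : differentiable F (0 : C).
  by apply: dF; rewrite /supnorm cre0 cim0 normr0 maxxx ltW.
have e'0 : 0 < e / 32 by rewrite divr_gt0.
have [d d0 Hd] := diff_nrm dF0 e'0.
pose s := Num.min r (d / 4).
have s0 : 0 < s by rewrite lt_min r0 divr_gt0.
have sr : s <= r by rewrite ge_min lexx.
have da z : s <= supnorm z <= r -> differentiable (fun z : C => F z * z^-1 ^+ 2) z.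
  move=> /andP[sz zr]; apply: differentiable_over_sqr; last exact: dF.
  by apply: supnorm_gt0; apply: lt_le_trans sz.
rewrite (square_int_annulus s0 sr da).
set a := 'd F 0 1.
pose G z := (F z - F 0 - a * z) * z^-1 ^+ 2.
have cs z : supnorm z = s -> z != 0 by move=> zs; apply: supnorm_gt0; rewrite zs.
have cF2 z : supnorm z = s -> cont_at (fun z => F z * z^-1 ^+ 2) z.
  move=> zs; apply/differentiable_continuous/differentiable_over_sqr; first exact: cs.
  by apply: dF; rewrite zs.
have ci2 z : supnorm z = s -> cont_at (fun z => z^-1 ^+ 2) z.
  move=> zs; apply/differentiable_continuous.
  by apply: (@differentiableX _ _ (fun z : C => z^-1) 1); apply/differentiable_inv/cs.
have ci z : supnorm z = s -> cont_at (fun z => z^-1) z.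
  by move=> zs; apply/differentiable_continuous/differentiable_inv/cs.
have cZ := cont_atZ.
have on z : on_rect (- s) s (- s) s z -> supnorm z = s by exact: on_square_supnorm.
have ss : - s <= s by lra.
have GE : square_int G s = square_int (fun z => F z * z^-1 ^+ 2) s - a * winding_const.
  transitivity (square_int (fun z => F z * z^-1 ^+ 2) s + (- F 0) * square_int (fun z => z^-1 ^+ 2) s
                + (- a) * square_int (fun z => z^-1) s).
    rewrite /square_int -!rect_intZ //; [|by move=> z /on /ci|by move=> z /on /ci2].
    rewrite -rect_intD //; [|by move=> z /on /cF2|by move=> z /on /ci2; exact: cZ].
    rewrite -rect_intD //; last 2 first.
    - move=> z /on zs; apply: cont_atD; first exact: cF2.
      by apply: cZ; exact: ci2.
    - by move=> z /on /ci; exact: cZ.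
    apply: eq_rect_int => // z /on /cs z0; rewrite /G; field => //.
  by rewrite (square_int_inv_sqr s0) (square_int_inv s0); ring.
have -> : winding_const * a - square_int (fun z => F z * z^-1 ^+ 2) s = - square_int G s by rewrite GE; ring.
rewrite nrmN; apply: le_trans (square_int_bound s0 (M := e / 16 / s) _ _) _.
- move=> z zs; have -> : G = (fun z : C => F z * z^-1 ^+ 2 + ((- F 0) * z^-1 ^+ 2 + (- a) * (z * z^-1 ^+ 2))).
    by apply/funext => t; rewrite /G; ring.
  apply: cont_atD; first exact: cF2.
  apply: cont_atD; first by apply: cZ; exact: ci2.
  apply: cZ; apply: cont_atM; first exact: cvg_id.
  exact: ci2.
- move=> z zs; have z0 := cs z zs; have nz0 : 0 < nrm z by rewrite nrm_gt0.
  have nz : nrm z < d.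
    apply: le_lt_trans (nrm_le_supnorm z) _; rewrite zs.
    have : s <= d / 4 by rewrite ge_min lexx orbT.
    lra.
  have := Hd z nz; rewrite add0r.
  have -> : 'd F 0 z = a * z.
    by rewrite -[in LHS](mulr1 z) -[_ * 1]/(_ *: _) linearZ /= mulrC.
  rewrite /G nrmM nrmX nrmV => H.
  apply: le_trans (ler_wpM2r (exprn_ge0 _ _) H) _; first by rewrite invr_ge0 ltW.
  have -> : e / 32 * nrm z * (nrm z)^-1 ^+ 2 = e / 32 / nrm z by field; rewrite gt_eqF.
  have : (nrm z)^-1 <= s^-1.
    by rewrite lef_pV2 ?posrE // -zs supnorm_le_nrm.
  move=> /(ler_wpM2l (ltW e'0))/le_trans; apply; rewrite ler_wpM2r ?invr_ge0 ?(ltW s0) //.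
  lra.
- by apply: eq_ler; field; rewrite gt_eqF.
Qed.

Lemma cauchy_deriv_bound F r M : 0 < r -> (forall z, supnorm z <= r -> differentiable F z) ->
  (forall z, supnorm z = r -> nrm (F z) <= M) -> nrm ('d F (0 : C) (1 : C)) <= 4 * M / r.
Proof.
move=> r0 dF FM; have c4 := nrm_winding_const.
have : nrm (winding_const * 'd F (0 : C) (1 : C)) <= 16 * (M * r^-1 ^+ 2) * r.
  rewrite (cauchy_deriv r0 dF); apply: (square_int_bound r0) => z zr.
    apply/differentiable_continuous/differentiable_over_sqr; first by apply: supnorm_gt0; rewrite zr.
    by apply: dF; rewrite zr.
  rewrite nrmM nrmX nrmV; have rz : r <= nrm z by rewrite -zr supnorm_le_nrm.
  have nz0 : 0 < nrm z by apply: lt_le_trans r0 rz.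
  apply: ler_pM; rewrite ?nrm_ge0 ?exprn_ge0 ?invr_ge0 ?(ltW nz0) ?FM //.
  by rewrite ler_pXn2r ?nnegrE ?invr_ge0 ?(ltW nz0) ?(ltW r0) // lef_pV2 ?posrE.
have -> : 16 * (M * r^-1 ^+ 2) * r = 4 * (4 * M / r) by field; rewrite gt_eqF.
rewrite nrmM => H; rewrite -(ler_pM2l (x := 4)) //; apply: le_trans H.
by rewrite ler_wpM2r // nrm_ge0.
Qed.

(** The previous estimate for z F(z), whose derivative at 0 is F(0). *)
Lemma cauchy_value_bound F r M : 0 < r -> (forall z, supnorm z <= r -> differentiable F z) ->
  (forall z, supnorm z = r -> nrm (F z) <= M) -> nrm (F 0) <= 8 * M.
Proof.
move=> r0 dF FM.
have dF0 : differentiable F (0 : C).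
  by apply: dF; rewrite /supnorm cre0 cim0 normr0 maxxx ltW.
pose G : C -> C := (id : C -> C) * F.
have dG z : supnorm z <= r -> differentiable G z.
  by move=> /dF dFz; apply: differentiableM; [exact: ex_diff|exact: dFz].
have := @cauchy_deriv_bound G r (2 * r * M) r0 dG.
have -> : 'd G 0 1 = F 0.
  have did : differentiable (id : C -> C) (0 : C) by exact: ex_diff.
  rewrite /G (diffM did dF0) /=.
  rewrite [X in X + _](_ : _ = 0) ?add0r; last exact: mul0r.
  by rewrite diff_val /= /GRing.scale /= mulr1.
have -> : 4 * (2 * r * M) / r = 8 * M by field; rewrite gt_eqF.
apply => z zr; rewrite /G nrmM; apply: ler_pM; rewrite ?nrm_ge0 ?FM //.
by rewrite -zr nrm_le_supnorm.
Qed.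
End CauchyFormula.

(** * Mean value inequalities *)

Section MeanValue.
Variable R : realType.
Local Notation C := (Cx R).

Lemma real_is_derive (g : R -> R) t l :
  (forall e : R, 0 < e -> exists2 d : R, 0 < d & forall s, `|s| < d ->
     `|g (t + s) - g t - l * s| <= e * `|s|) -> is_derive t 1 g l.
Proof.
move=> H; suff cl : h^-1 *: ((g \o shift t) (h *: 1) - g t) @[h --> 0^'] --> l.
  by apply: DeriveDef; [apply/cvg_ex; exists l|exact: cvg_lim].
apply/cvgrPdist_le => e e0; have [d d0 Hd] := H e e0.
near=> h.
have h0 : h != 0 by near: h; exact: nbhs_dnbhs_neq.
have hd : `|h| < d by near: h; apply: dnbhs0_lt.
have := Hd h hd; rewrite /= [h *: 1]mulr1 [h + t]addrC => H1.
rewrite -(ler_pM2r (x := `|h|)) ?normr_gt0 // -normrM mulrBl.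
rewrite -[_ *: _]/(_ * _) mulrAC mulVf // mul1r distrC; exact: H1.
Unshelve. all: by end_near. Qed.

Definition cconj (w : C) : C := cplx (cre w) (- cim w).

Lemma cre_conjM (w : C) : cre (cconj w * w) = nrm w ^+ 2.
Proof. by rewrite nrm_sqr !creimE; ring. Qed.
Lemma nrm_conj (w : C) : nrm (cconj w) = nrm w.
Proof.
by apply/eqP; rewrite -[_ == _](@eqrXn2 _ 2) ?nrm_ge0 // !nrm_sqr !creimE sqrrN.
Qed.

Lemma diff1M (F : C -> C) (z h : C) : 'd F z h = h * 'd F z (1 : C).
Proof. by rewrite -[in LHS](mulr1 h) -[_ * 1]/(_ *: _) linearZ. Qed.

Lemma is_derive_real (F : C -> C) c t : differentiable F (ofR t) ->
  is_derive t 1 (fun s => cre (c * F (ofR s))) (cre (c * 'd F (ofR t) (1 : C))).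
Proof.
move=> dF; apply: real_is_derive => e e0.
have [|d d0 Hd] := diff_nrm dF (e := e / (nrm c + 1)).
  by rewrite divr_gt0 // ltr_wpDl // nrm_ge0.
exists d => // s sd; rewrite ofRD.
have -> : cre (c * F (ofR t + ofR s)) - cre (c * F (ofR t)) - cre (c * 'd F (ofR t) (1 : C)) * s
   = cre (c * (F (ofR t + ofR s) - F (ofR t) - 'd F (ofR t) (ofR s))).
  by rewrite (diff1M _ _ (ofR s)) !creimE; ring.
apply: le_trans (cre_le_nrm _) _; rewrite nrmM.
have := Hd (ofR s); rewrite nrm_ofR => /(_ sd) H.
apply: le_trans (ler_wpM2l (nrm_ge0 _) H) _.
rewrite mulrA ler_wpM2r // mulrC -mulrA ler_piMr ?(ltW e0) // mulrC ler_pdivrMr ?ltr_wpDl ?nrm_ge0 //.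
by rewrite mul1r lerDl.
Qed.

(** With w = F(x) - F(0), the real function
    |w| M t^(m+1) / (m+1) - Re (conj(w) F(t)) has nonnegative derivative, so it
    increases from t = 0 to t = x. *)
Lemma mean_value_pow (F : C -> C) (M x : R) m : 0 <= x ->
  (forall t, 0 <= t <= x -> differentiable F (ofR t)) ->
  (forall t, 0 <= t <= x -> nrm ('d F (ofR t) (1 : C)) <= M * t ^+ m) ->
  nrm (F (ofR x) - F 0) <= M * x ^+ m.+1 / m.+1%:R.
Proof.
move=> x0 dF FM; set w := F (ofR x) - F 0.
have [w0|w0] := eqVneq (nrm w) 0.
  rewrite w0; have [x00|xn0] := eqVneq x 0; first by rewrite x00 expr0n /= mulr0 mul0r.
  have xp : 0 < x by rewrite lt0r xn0.
  have : 0 <= M * x ^+ m by apply: le_trans (nrm_ge0 _) (FM x _); rewrite x0 lexx.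
  by rewrite pmulr_lge0 ?exprn_gt0 // => M0; rewrite divr_ge0 ?mulr_ge0 ?exprn_ge0.
have wp : 0 < nrm w by rewrite lt0r w0 nrm_ge0.
move: x0; rewrite le_eqVlt => /predU1P[x0|x0].
  by move: wp; rewrite /w -x0 ofR0 subrr nrm0 ltxx.
pose k1 (t : R) := nrm w * M / m.+1%:R * t ^+ m.+1.
pose k2 t := cre (cconj w * F (ofR t)).
have d1 (t : R) : is_derive t 1 k1 (nrm w * M * t ^+ m).
  have dX : derivable (fun s : R => s ^+ m.+1) t 1 by exact: exprn_derivable.
  have dc : derivable (cst (nrm w * M / m.+1%:R)) t 1 by exact: derivable_cst.
  have -> : k1 = cst (nrm w * M / m.+1%:R) * (fun s : R => s ^+ m.+1) by [].
  apply: DeriveDef; first exact: (derivableM dc dX).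
  rewrite (deriveM dc dX) derive_cst scaler0 addr0 exp_derive /GRing.scale /= mulr1.
  by rewrite mulrA divfK ?pnatr_eq0.
have d2 t : 0 <= t <= x -> is_derive t 1 k2 (cre (cconj w * 'd F (ofR t) (1 : C))).
  by move=> tx; apply: is_derive_real; apply: dF.
have dk t : 0 <= t <= x ->
    is_derive t 1 (k1 - k2) (nrm w * M * t ^+ m - cre (cconj w * 'd F (ofR t) (1 : C))).
  by move=> tx; have := d1 t; have := d2 t tx => i2 i1; exact: is_deriveB.
have [||c cx E] := @MVT R (k1 - k2)
    (fun t => nrm w * M * t ^+ m - cre (cconj w * 'd F (ofR t) (1 : C))) 0 x x0.
- by move=> t; rewrite in_itv /= => /andP[t0 tx]; apply: dk; rewrite (ltW t0) (ltW tx).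
- apply: continuous_in_subspaceT => t; rewrite inE /= in_itv /= => tx.
  by apply: differentiable_continuous; apply/derivable1_diffP; case: (dk t tx).
have cx' : 0 <= c <= x by move: cx; rewrite in_itv /= => /andP[/ltW-> /ltW->].
have pos : 0 <= (k1 - k2) x - (k1 - k2) 0.
  rewrite E subr0 mulr_ge0 ?(ltW x0) // subr_ge0.
  apply: le_trans (ler_norm _) _; apply: le_trans (cre_le_nrm _) _.
  by rewrite nrmM nrm_conj -mulrA ler_wpM2l ?nrm_ge0 // FM.
have kE : (k1 - k2) x - (k1 - k2) 0 = nrm w * (M * x ^+ m.+1 / m.+1%:R) - nrm w ^+ 2.
  have -> : nrm w ^+ 2 = k2 x - k2 0.
    by rewrite -cre_conjM /k2 ofR0 -creB -mulrBr.
  have -> : (k1 - k2) x = k1 x - k2 x by [].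
  have -> : (k1 - k2) 0 = k1 0 - k2 0 by [].
  by rewrite /k1 expr0n /= mulr0; ring.
by move: pos; rewrite kE subr_ge0 expr2 ler_pM2l.
Qed.

Variable V : normedModType C.
Implicit Types (f : V -> C) (z h e : V).

Lemma line_diff f z h (t : C) : differentiable f (z + t *: h) ->
  differentiable (fun s : C => f (z + s *: h)) t /\
  forall s, 'd (fun s : C => f (z + s *: h)) t s = 'd f (z + t *: h) (s *: h).
Proof.
move=> df.
pose k : C := 'd f (z + t *: h) h.
pose A (s : C) : C := s * k.
have linA : linear A by move=> a u v; rewrite /A mulrDl scalerAl.
pose A' := GRing.isLinear.Build C C C _ A linA.
pose AL : {linear C -> C} := HB.pack A A'.
have cA : continuous AL.
  by move=> s; exact: (@cont_atM R (fun s => s) (fun=> k) s (@cvg_id _ _) (@cont_at_cst R k s)).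
have [|dF dE] := @nrm_diff R C C (fun s : C => f (z + s *: h)) t AL cA.
  move=> e e0; have [|d d0 Hd] := diff_nrm df (e := e / (nrm h + 1)).
    by rewrite divr_gt0 // ltr_wpDl // nrm_ge0.
  exists (d / (nrm h + 1)); first by rewrite divr_gt0 // ltr_wpDl // nrm_ge0.
  move=> s; rewrite ltr_pdivlMr ?ltr_wpDl ?nrm_ge0 // => sd.
  have : nrm (s *: h) < d.
    by rewrite nrmZ; apply: le_lt_trans sd; rewrite ler_wpM2l ?nrm_ge0 // lerDl.
  move=> /Hd; rewrite linearZ scalerDl addrA => /le_trans; apply.
  have -> : e / (nrm h + 1) * nrm (s *: h) = e * nrm s * (nrm h / (nrm h + 1)).
    by rewrite nrmZ; ring.
  rewrite ler_piMr ?mulr_ge0 ?nrm_ge0 ?(ltW e0) //.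
  by rewrite ler_pdivrMr ?ltr_wpDl ?nrm_ge0 // mul1r lerDl.
by split=> // s; rewrite dE linearZ.
Qed.

(** The one-variable estimate on the complex line through z in the direction h,
    on a square of size s / (4 |h|). *)
Lemma cauchy_dir f z (s M : R) h : 0 < s ->
  (forall w, nrm (w - z) < s -> differentiable f w) ->
  (forall w, nrm (w - z) < s -> nrm (f w) <= M) ->
  nrm ('d f z h) <= 16 * M / s * nrm h.
Proof.
move=> s0 df fM; have [->|h0] := eqVneq h 0; first by rewrite linear0 !nrm0 mulr0.
have nh : 0 < nrm h by rewrite nrm_gt0.
pose r := s / (4 * nrm h); have r0 : 0 < r by rewrite divr_gt0 // mulr_gt0.
have near (t : C) : supnorm t <= r -> nrm (z + t *: h - z) < s.
  move=> tr; rewrite addrC addKr nrmZ.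
  apply: le_lt_trans (ler_wpM2r (nrm_ge0 _) (nrm_le_supnorm t)) _.
  apply: le_lt_trans (_ : 2 * r * nrm h < s).
    by rewrite ler_wpM2r ?nrm_ge0 // ler_wpM2l.
  have -> : 2 * r * nrm h = s / 2 by rewrite /r; field; rewrite gt_eqF.
  lra.
have dz : differentiable f (z + (0 : C) *: h).
  by apply: df; rewrite scale0r addr0 subrr nrm0.
have := @cauchy_deriv_bound R (fun t => f (z + t *: h)) r M r0.
have -> : 16 * M / s * nrm h = 4 * M / r by rewrite /r; field; rewrite !gt_eqF.
have -> : 'd f z h = 'd (fun t : C => f (z + t *: h)) (0 : C) (1 : C).
  by rewrite (line_diff dz).2 scale0r addr0 scale1r.
apply.
  by move=> t /near tr; apply: (line_diff (df _ tr)).1.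
by move=> t tr; apply: fM; apply: near; rewrite tr.
Qed.

Lemma mean_value_dir f z h (M : R) :
  (forall t, 0 <= t <= 1 -> differentiable f (z + ofR t *: h)) ->
  (forall t, 0 <= t <= 1 -> nrm ('d f (z + ofR t *: h) h) <= M) ->
  nrm (f (z + h) - f z) <= M.
Proof.
move=> df fM; have := @mean_value_pow (fun t => f (z + t *: h)) M 1 0 ler01.
rewrite ofR1 scale1r scale0r addr0 expr1 mulr1 divr1; apply.
  by move=> t /df /line_diff[].
by move=> t t01; rewrite (line_diff (df _ t01)).2 scale1r ?expr0 ?mulr1; exact: fM.
Qed.
End MeanValue.

(** * Derivatives of holomorphic functions are holomorphic *)

Section DerivativeIsHolomorphic.
Variable R : realType.
Local Notation C := (Cx R).
Variable V : normedModType C.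
Implicit Types (f : V -> C) (z h e : V).

Lemma nrm_remainderB (a b c a' b' c' : C) :
  nrm (a - a' - (b - b') - (c - c')) <= nrm (a - b - c) + nrm (a' - b' - c').
Proof.
rewrite -[X in _ <= _ + X]nrmN; apply: le_trans (nrmD _ _).
by apply: eq_ler; congr nrm; ring.
Qed.

Lemma add_subl (a b : V) : a + b - a = b. Proof. by rewrite addrC addKr. Qed.
Lemma add_subl2 (a b c : V) : a + b + c - a = b + c. Proof. by rewrite -(addrA a) add_subl. Qed.

Lemma diff_sub_linear f (A : {linear V -> C}) z w : continuous A -> differentiable f w ->
  differentiable (fun w => f w - A (w - z)) w /\
  forall k, 'd (fun w => f w - A (w - z)) w k = 'd f w k - A k.
Proof.
move=> cA dfw.
have [||dh dhE] := @nrm_diff R V C (fun w => f w - A (w - z)) w ('d f w \- A).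
- by move=> y; apply: continuousB; [exact: diff_continuous|exact: cA].
- move=> e e0; have [d d0 Hd] := diff_nrm dfw e0.
  exists d => // k /Hd; rewrite /= [w + k - z]addrAC linearD.
  set a := f (w + k); set b := f w; set c := A _; set c' := A k; set d' := 'd f w k.
  have -> // : a - (c + c') - (b - c) - (d' - c') = a - b - d' by ring.
split; first exact: dh.
by move=> k; exact: (congr1 (fun u : V -> C => u k) dhE).
Qed.

Section Bounds.
Variables (f : V -> C) (z0 : V) (p M : R).
Hypothesis p0 : 0 < p.
Hypothesis df : forall w, nrm (w - z0) < 4 * p -> differentiable f w.
Hypothesis fM : forall w, nrm (w - z0) < 4 * p -> nrm (f w) <= M.

Let tri (a b c : V) (r s : R) : nrm (a - b) < r -> nrm (b - c) < s -> nrm (a - c) < r + s.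
Proof.
move=> h1 h2; apply: le_lt_trans (ltrD h1 h2).
by apply: le_trans (nrmD _ _); rewrite addrA subrK.
Qed.

Let K := 16 * M / p.
Let M0 : 0 <= M.
Proof. by apply: le_trans (nrm_ge0 _) (fM (w := z0) _); rewrite subrr nrm0 mulr_gt0. Qed.
Let K0 : 0 <= K. Proof. by rewrite divr_ge0 ?mulr_ge0 // ltW. Qed.

Let diff_bound z h : nrm (z - z0) < 3 * p -> nrm ('d f z h) <= K * nrm h.
Proof.
move=> zp; apply: (cauchy_dir _ p0) => w wz.
  by apply: df; have := tri wz zp; rewrite (_ : p + 3 * p = 4 * p) //; ring.
by apply: fM; have := tri wz zp; rewrite (_ : p + 3 * p = 4 * p) //; ring.
Qed.

Let segment (z h : V) (r t : R) : nrm (z - z0) < r -> nrm (z + h - z0) < r -> 0 <= t <= 1 ->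
  nrm (z + ofR t *: h - z0) < r.
Proof.
move=> h1 h2 /andP[t0 t1].
have -> : z + ofR t *: h - z0 = ofR (1 - t) *: (z - z0) + ofR t *: (z + h - z0).
  rewrite ofRB ofR1 scalerBl scale1r ![z + _ - z0]addrAC; move: (z - z0) => u.
  by rewrite scalerDr addrA subrK.
apply: le_lt_trans (nrmD _ _) _; rewrite !nrmZ !nrm_ofR !ger0_norm ?subr_ge0 //.
apply: le_lt_trans (_ : Num.max (nrm (z - z0)) (nrm (z + h - z0)) < r); last by rewrite gt_max h1.
set m := Num.max _ _; have -> : m = (1 - t) * m + t * m by ring.
by apply: lerD; apply: ler_wpM2l; rewrite ?subr_ge0 // le_max lexx ?orbT.
Qed.

(** Mean value inequality on the segment from z to z + h, the differential being
    bounded by the Cauchy estimate. *)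
Lemma holo_lipschitz z h : nrm (z - z0) < 3 * p -> nrm (z + h - z0) < 3 * p ->
  nrm (f (z + h) - f z) <= K * nrm h.
Proof.
move=> h1 h2; apply: mean_value_dir => t t01.
  apply: df; apply: lt_trans (segment h1 h2 t01) _; rewrite ltr_pM2r //; lra.
by apply: diff_bound; apply: segment.
Qed.

Let K2 := 16 * K / p.
Let K20 : 0 <= K2. Proof. exact: divr_ge0 (mulr_ge0 (ler0n _ _) K0) (ltW p0). Qed.

(** Cauchy estimate for the difference y |-> f(y + k) - f(y), which is O(|k|) by
    [holo_lipschitz]. *)
Let diff_lipschitz z k h : nrm (z - z0) < 2 * p -> nrm (z + k - z0) < 2 * p ->
  nrm ('d f (z + k) h - 'd f z h) <= K2 * nrm k * nrm h.
Proof.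
move=> h1 h2.
have near y : nrm (y - z) < p -> nrm (y - z0) < 3 * p /\ nrm (y + k - z0) < 3 * p.
  move=> yz; have p3 : p + 2 * p = 3 * p by ring.
  split; first by have := tri yz h1; rewrite p3.

  have yz' : nrm (y + k - (z + k)) < p by rewrite opprD addrACA subrr addr0.
  by have := tri yz' h2; rewrite p3.
have far y : nrm (y - z0) < 3 * p -> differentiable f y.
  by move=> yp; apply: df; apply: lt_trans yp _; rewrite ltr_pM2r //; lra.
have dk y : nrm (y - z) < p -> differentiable (fun y => f (y + k)) y /\
   forall h, 'd (fun y => f (y + k)) y h = 'd f (y + k) h.
  move=> /near[_ /far dfy].
  have [||dg dgE] := @nrm_diff R V C (fun y => f (y + k)) y ('d f (y + k)).
  - exact: diff_continuous.
  - move=> e e0; have [d d0 Hd] := diff_nrm dfy e0; exists d => // h' /Hd.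
    by rewrite [y + k + h']addrAC.
  by split => // h'; rewrite dgE.
have dg y : nrm (y - z) < p -> differentiable (fun y => f (y + k) - f y) y.
  move=> yz; have [dk1 _] := dk y yz; have [/far dfy _] := near y yz.
  exact: (differentiableB dk1 dfy).
have zz : nrm (z - z) < p by rewrite subrr nrm0.
have -> : 'd f (z + k) h - 'd f z h = 'd (fun y => f (y + k) - f y) z h.
  have [dk1 dk2] := dk z zz; have [/far dfz _] := near z zz.
  have [||dh dhE] := @nrm_diff R V C (fun y => f (y + k) - f y) z
     ('d (fun y => f (y + k)) z \- 'd f z).
  - by move=> y; apply: continuousB; exact: diff_continuous.
  - move=> e e0; have e2 : 0 < e / 2 by rewrite divr_gt0.
    have [d1 d10 Hd1] := diff_nrm dk1 e2; have [d2 d20 Hd2] := diff_nrm dfz e2.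
    exists (Num.min d1 d2); first by rewrite lt_min d10.
    move=> h'; rewrite lt_min => /andP[/Hd1 i1 /Hd2 i2].
    apply: le_trans (_ : (e / 2) * nrm h' + (e / 2) * nrm h' <= _); last by apply: eq_ler; field.
    by apply: le_trans (lerD i1 i2); exact: nrm_remainderB.
  rewrite -(dk2 h); exact: esym (congr1 (fun u : V -> C => u h) dhE).
have -> : K2 * nrm k * nrm h = 16 * (K * nrm k) / p * nrm h by rewrite /K2; move: K (nrm k) (nrm h) => a b c; ring.
by apply: (cauchy_dir _ p0 dg) => w /near[w1 w2]; exact: holo_lipschitz.
Qed.

(** Mean value inequality for w |-> f(w) - df(z)(w - z), whose differential at w
    is O(|w - z|) by [diff_lipschitz]. *)
Let taylor z h : nrm (z - z0) < 2 * p -> nrm (z + h - z0) < 2 * p ->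
  nrm (f (z + h) - f z - 'd f z h) <= K2 * nrm h * nrm h.
Proof.
move=> h1 h2.
have dfz : differentiable f z by apply: df; apply: lt_trans h1 _; rewrite ltr_pM2r //; lra.
pose g w := f w - 'd f z (w - z).
have dg w : nrm (w - z0) < 4 * p -> differentiable g w /\ forall k, 'd g w k = 'd f w k - 'd f z k.
  by move=> /df dfw; apply: diff_sub_linear dfw; exact: diff_continuous.
have -> : f (z + h) - f z - 'd f z h = g (z + h) - g z.
  by rewrite /g [z + h]addrC addrK subrr linear0; ring.
have lt4 t : 0 <= t <= 1 -> nrm (z + ofR t *: h - z0) < 4 * p.
  by move=> t01; apply: lt_trans (segment h1 h2 t01) _; rewrite ltr_pM2r //; lra.
apply: mean_value_dir => t t01; first by have [] := dg _ (lt4 t t01).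
have [_ ->] := dg _ (lt4 t t01).
apply: le_trans (diff_lipschitz _ _ _) _ => //; first exact: segment.
rewrite ler_wpM2r ?nrm_ge0 // ler_wpM2l // nrmZ nrm_ofR; have /andP[t0 t1] := t01.
by rewrite ger0_norm // ler_piMl // nrm_ge0.
Qed.

(** Cauchy's formula writes df(z)(e) as a square integral of f(z + t e) / t^2 dt,
    which is differentiated under the integral sign: the remainder of order 2 of
    f is uniform in t by [taylor]. *)
Lemma differentiable_derive_bounded e : differentiable (fun w => 'd f w e) z0.
Proof.
pose r := p / (2 * (nrm e + 1)).
have e1 : 0 < nrm e + 1 by rewrite ltr_wpDl // nrm_ge0.
have r0 : 0 < r by rewrite divr_gt0 // mulr_gt0.
have rr : - r <= r by rewrite lerNl; lra.
have near (t : C) : supnorm t <= r -> nrm (t *: e) < p.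
  move=> tr; rewrite nrmZ; apply: le_lt_trans (ler_wpM2r (nrm_ge0 _) (nrm_le_supnorm t)) _.
  apply: le_lt_trans (_ : 2 * r * nrm e < p).
    by rewrite ler_wpM2r ?nrm_ge0 // ler_wpM2l.
  have -> : 2 * r * nrm e = p * (nrm e / (nrm e + 1)) by rewrite /r; field; rewrite gt_eqF.
  by rewrite gtr_pMr // ltr_pdivrMr // mul1r ltrDl.
have onr t : on_rect (- r) r (- r) r t -> supnorm t = r by exact: on_square_supnorm.
have z0p : nrm (z0 - z0) < p by rewrite subrr nrm0.
have nz (t : C) : supnorm t = r -> t != 0 by move=> tr; apply: supnorm_gt0; rewrite tr.
have cinv2 (t : C) : supnorm t = r -> cont_at (fun t => t^-1 ^+ 2) t.
  move=> tr; apply/differentiable_continuous.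
  by apply: (@differentiableX _ _ (fun z : C => z^-1) 1); apply/differentiable_inv/nz.
have cauchy h : nrm h < p ->
    winding_const R * 'd f (z0 + h) e = square_int (fun t => f (z0 + h + t *: e) * t^-1 ^+ 2) r.
  move=> hp.
  have dfh (t : C) : supnorm t <= r -> differentiable f (z0 + h + t *: e).
    move=> /near tp; apply: df; rewrite add_subl2.
    by apply: le_lt_trans (nrmD _ _) _; have := p0; have := ltrD hp tp; set a := nrm h + _; move=> *; lra.
  have sn0 : supnorm (0 : C) <= r by rewrite /supnorm cre0 cim0 normr0 maxxx ltW.
  have [_ dE] := line_diff (dfh 0 sn0).
  rewrite -(cauchy_deriv r0); last by move=> t /dfh /line_diff[].
  by rewrite dE scale1r scale0r addr0.
have cauchy0 : winding_const R * 'd f z0 e = square_int (fun t => f (z0 + t *: e) * t^-1 ^+ 2) r.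
  by have := cauchy 0; rewrite nrm0 addr0; apply.
pose g h (t : C) := 'd f (z0 + t *: e) h * t^-1 ^+ 2.
have cdf h (t : C) : supnorm t <= r -> cont_at (fun t => 'd f (z0 + t *: e) h) t.
  move=> tr; apply/continuous_nrmP => eps eps0.
  pose L := K2 * nrm e * nrm h + 1.
  have L0 : 0 < L by rewrite ltr_wpDl //; exact: mulr_ge0 (mulr_ge0 K20 (nrm_ge0 _)) (nrm_ge0 _).
  have t1 := near t tr.
  exists (Num.min (eps / L) (p / (nrm e + 1))); first by rewrite lt_min !divr_gt0.
  move=> s; rewrite lt_min !ltr_pdivlMr // => /andP[s1 s2].
  rewrite scalerDl addrA.
  have se : nrm (s *: e) < p.
    by rewrite nrmZ; apply: le_lt_trans s2; rewrite ler_wpM2l ?nrm_ge0 // lerDl.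
  apply: le_lt_trans (diff_lipschitz _ _ _) _.
  - by rewrite add_subl; have := p0; move: t1; move=> *; lra.
  - by rewrite add_subl2; apply: le_lt_trans (nrmD _ _) _; rewrite mulr_natl mulr2n ltrD.
  apply: le_lt_trans s1; rewrite nrmZ /L mulrDr mulr1.
  have -> : K2 * (nrm s * nrm e) * nrm h = nrm s * (K2 * nrm e * nrm h) by ring.
  by rewrite lerDl nrm_ge0.
have cg h (t : C) : supnorm t = r -> cont_at (g h) t.
  move=> tr; apply: cont_atM; last exact: cinv2.
  by apply: cdf; rewrite tr.
pose A h : C := (winding_const R)^-1 * square_int (g h) r.
have cc : 4 <= nrm (winding_const R) := nrm_winding_const R.
have cc0 : winding_const R != 0 by rewrite -nrm_gt0; apply: lt_le_trans cc.
have linA : linear A.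
  move=> a u v; rewrite /A.
  have -> : square_int (g (a *: u + v)) r = a * square_int (g u) r + square_int (g v) r.
    rewrite /square_int -rect_intZ //; last by move=> t /onr; exact: cg.
    rewrite -rect_intD //; last 2 first.
    - by move=> t /onr tr; apply: cont_atZ; exact: cg.
    - by move=> t /onr; exact: cg.
    apply: eq_rect_int => // t _; rewrite /g linearP mulrDl; congr (_ + _); exact: esym (mulrA _ _ _).
  by rewrite mulrDr mulrCA.
have rt (t : C) : supnorm t = r -> nrm (t^-1 ^+ 2) <= r^-1 ^+ 2.
  move=> tr; have rt : r <= nrm t by rewrite -tr supnorm_le_nrm.
  have t0 : 0 < nrm t by apply: lt_le_trans r0 rt.
  by rewrite nrmX nrmV ler_pXn2r ?nnegrE ?invr_ge0 ?(ltW t0) ?(ltW r0) // lef_pV2 ?posrE.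
have rN0 : r != 0 by rewrite gt_eqF.
have winding_bound (w : C) (B : R) : nrm w <= 16 * (B * r^-1 ^+ 2) * r -> nrm ((winding_const R)^-1 * w) <= 4 / r * B.
  move=> wB; rewrite nrmM nrmV mulrC ler_pdivrMr ?(lt_le_trans _ cc) //.
  have E : 16 * (B * r^-1 ^+ 2) * r = 4 / r * B * 4 by field.
  have B0 : 0 <= 4 / r * B by have := le_trans (nrm_ge0 w) wB; rewrite E pmulr_lge0.
  by apply: le_trans wB _; rewrite E ler_wpM2l.
have Ab h : nrm (A h) <= 4 / r * (K * nrm h).
  apply: winding_bound; apply: (square_int_bound r0) => t tr; first exact: cg.
  rewrite nrmM; apply: ler_pM; rewrite ?nrm_ge0 //; last exact: rt.
  apply: diff_bound; rewrite add_subl.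
  have t1 := near t; rewrite tr lexx in t1; have := t1 isT; have := p0; move=> *; lra.
pose A' := GRing.isLinear.Build C V C _ A linA.
pose AL : {linear V -> C} := HB.pack A A'.
have cA : continuous AL.
  move=> z; apply/continuous_nrmP => eps eps0.
  pose L := 4 / r * K + 1.
  have L0 : 0 < L by rewrite ltr_wpDl //; exact: mulr_ge0 (divr_ge0 (ler0n _ 4) (ltW r0)) K0.
  exists (eps / L); first exact: divr_gt0.
  move=> h; rewrite ltr_pdivlMr // => hL; rewrite linearD addrC addKr.
  apply: le_lt_trans (Ab h) _; apply: le_lt_trans hL.
  have -> : 4 / r * (K * nrm h) = nrm h * (4 / r * K) by move: K => k; ring.
  by rewrite ler_wpM2l ?nrm_ge0 // lerDl.
have [|//] := @nrm_diff R V C (fun w => 'd f w e) z0 AL cA.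
move=> eps eps0.
pose L := 4 / r * K2 + 1.
have L0 : 0 < L by rewrite ltr_wpDl //; exact: mulr_ge0 (divr_ge0 (ler0n _ 4) (ltW r0)) K20.
exists (Num.min p (eps / L)); first by rewrite lt_min p0 divr_gt0.
move=> h; rewrite lt_min ltr_pdivlMr // => /andP[hp hL].
pose rem t := f (z0 + h + t *: e) - f (z0 + t *: e) - 'd f (z0 + t *: e) h.
have cfh k (t : C) : nrm k < p -> supnorm t = r -> cont_at (fun t => f (z0 + k + t *: e)) t.
  move=> kp tr; apply: differentiable_continuous.
  apply: (line_diff (df _)).1; rewrite add_subl2.
  have t1 := near t; rewrite tr lexx in t1; have t2 := t1 isT.
  apply: le_lt_trans (nrmD _ _) _; have := ltrD kp t2; have := p0; move=> *; lra.
have n0 : nrm (0 : V) < p by rewrite nrm0.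
have cf0 (t : C) : supnorm t = r -> cont_at (fun t => f (z0 + t *: e)) t.
  by move=> tr; have := cfh 0 t n0 tr; rewrite addr0.
have crem (t : C) : supnorm t = r -> cont_at (fun t => rem t * t^-1 ^+ 2) t.
  move=> tr; apply: cont_atM; last exact: cinv2.
  have -> : rem = (fun t => (f (z0 + h + t *: e) + (-1) * f (z0 + t *: e)) + (-1) * 'd f (z0 + t *: e) h).
    by apply/funext => t'; rewrite !mulN1r.
  apply: cont_atD; last by apply: cont_atZ; apply: cdf; rewrite tr.
  by apply: cont_atD; [exact: cfh|apply: cont_atZ; exact: cf0].
have E : 'd f (z0 + h) e - 'd f z0 e - A h = (winding_const R)^-1 * square_int (fun t => rem t * t^-1 ^+ 2) r.
  have -> : square_int (fun t => rem t * t^-1 ^+ 2) r =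
      square_int (fun t => f (z0 + h + t *: e) * t^-1 ^+ 2) r
      + (-1) * square_int (fun t => f (z0 + t *: e) * t^-1 ^+ 2) r + (-1) * square_int (g h) r.
    rewrite /square_int -!rect_intZ //; last 2 first.
    - by move=> t /onr; exact: cg.
    - by move=> t /onr tr; apply: cont_atM; [exact: cf0|exact: cinv2].
    rewrite -rect_intD //; last 2 first.
    - by move=> t /onr tr; apply: cont_atM; [exact: cfh|exact: cinv2].
    - by move=> t /onr tr; apply: cont_atZ; apply: cont_atM; [exact: cf0|exact: cinv2].
    rewrite -rect_intD //; last 2 first.
    - move=> t /onr tr; apply: cont_atD; first by apply: cont_atM; [exact: cfh|exact: cinv2].
      by apply: cont_atZ; apply: cont_atM; [exact: cf0|exact: cinv2].
    - by move=> t /onr tr; apply: cont_atZ; exact: cg.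
    apply: eq_rect_int => // t _; rewrite /rem /g.
    by set a := f _; set b := f _; set c := 'd f _ _; ring.
  rewrite -(cauchy h hp) -cauchy0 /A.
  set a := 'd f (z0 + h) e; set b := 'd f z0 e; set c := square_int _ _.
  by field.
rewrite -[AL h]/(A h) E.
apply: le_trans (winding_bound _ (K2 * nrm h * nrm h) _) _.
  apply: (square_int_bound r0) => t tr; first exact: crem.
  rewrite nrmM; apply: ler_pM; rewrite ?nrm_ge0 //; last exact: rt.
  have t1 := near t; rewrite tr lexx in t1; have t2 := t1 isT.
  rewrite /rem [z0 + h + _]addrAC; apply: taylor; rewrite ?add_subl2 ?add_subl.
    by have := p0; move: t2; move=> *; lra.
  by apply: le_lt_trans (nrmD _ _) _; rewrite mulr_natl mulr2n ltrD.
have -> : 4 / r * (K2 * nrm h * nrm h) = nrm h * (4 / r * K2) * nrm h by move: K2 => k; ring.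
rewrite ler_wpM2r ?nrm_ge0 //; apply: le_trans (ltW hL).
by rewrite ler_wpM2l ?nrm_ge0 // lerDl.
Qed.
End Bounds.

Lemma differentiable_derive f (z e : V) : (\forall w \near z, differentiable f w) ->
  differentiable (fun w => 'd f w e) z.
Proof.
move=> /nbhs_nrmP[d d0 Hd].
have dfz : differentiable f z by have := Hd 0; rewrite addr0 nrm0; apply.
have /continuous_nrmP/(_ _ ltr01)[d' d'0 Hd'] := differentiable_continuous dfz.
pose p := Num.min d d' / 4.
have m0 : 0 < Num.min d d' by rewrite lt_min d0.
have pE : 4 * p = Num.min d d' by rewrite /p; field.
have p0 : 0 < p by rewrite divr_gt0.
apply: (@differentiable_derive_bounded f z p (nrm (f z) + 1) p0).
  by move=> w; rewrite pE lt_min => /andP[/Hd]; rewrite addrC subrK.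
move=> w; rewrite pE lt_min => /andP[_ /Hd']; rewrite [z + _]addrC subrK => h.
rewrite -[f w](subrK (f z)) addrC; apply: le_trans (nrmD _ _) _.
by rewrite lerD2l ltW.
Qed.
End DerivativeIsHolomorphic.

(** * Functions with all derivatives zero at a point *)

Section IteratedDerivative.
Variable R : realType.
Local Notation C := (Cx R).
Variable V : normedModType C.
Implicit Types (f : V -> C) (z h e w : V).

Definition iter_diff e m f : V -> C := iter m (fun g w => 'd g w e) f.

Lemma iter_diffS e m f w : iter_diff e m.+1 f w = 'd (iter_diff e m f) w e.
Proof. by []. Qed.

Lemma near_ball z (s : R) w (P : V -> Prop) : nrm (w - z) < s ->
  (forall y, nrm (y - z) < s -> P y) -> \forall y \near w, P y.
Proof.
move=> ws HP; apply/nbhs_nrmP; exists (s - nrm (w - z)); first by rewrite subr_gt0.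
move=> h; rewrite ltrBrDl => hs; apply: HP; apply: le_lt_trans hs.
by rewrite addrAC; exact: nrmD.
Qed.

Lemma iter_diff_differentiable f z (s : R) e m :
  (forall w, nrm (w - z) < s -> differentiable f w) ->
  forall w, nrm (w - z) < s -> differentiable (iter_diff e m f) w.
Proof.
move=> df; elim: m => [//|m IH] w ws; apply: differentiable_derive.
exact: near_ball ws IH.
Qed.

(** Each derivative costs a Cauchy estimate on balls of radius d. *)
Lemma iter_diff_bound f z (s M d : R) e m : 0 < d -> 
  (forall w, nrm (w - z) < s -> differentiable f w) ->
  (forall w, nrm (w - z) < s -> nrm (f w) <= M) ->
  forall w, nrm (w - z) < s - m%:R * d -> nrm (iter_diff e m f w) <= M * (16 * nrm e / d) ^+ m.
Proof.
move=> d0 df fM; elim: m => [|m IH] w.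
  by rewrite mul0r subr0 expr0 mulr1; exact: fM.
move=> ws; have near y : nrm (y - w) < d -> nrm (y - z) < s - m%:R * d.
  move=> yw; apply: le_lt_trans (_ : nrm (y - w) + nrm (w - z) < _).
    by apply: le_trans (nrmD _ _); rewrite addrA subrK.
  by move: (ltrD yw ws); rewrite -natr1 mulrDl mul1r; set a := m%:R * d; lra.
have sub y : nrm (y - w) < d -> nrm (y - z) < s.
  by move=> /near ys; apply: lt_le_trans ys _; rewrite lerBlDr lerDl mulr_ge0 // ltW.
have dD y : nrm (y - w) < d -> differentiable (iter_diff e m f) y.
  by move=> /sub; exact: iter_diff_differentiable.
have := cauchy_dir e d0 dD (fun y yw => IH y (near y yw)).
rewrite iter_diffS exprS => /le_trans; apply; apply: eq_ler.
by set q := _ ^+ m; field; rewrite gt_eqF.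
Qed.

(** From (1 + 1/n)^n <= exp 1.  It compares the loss N^N of the N-fold Cauchy
    estimate with the gain N! of Taylor's formula. *)
Lemma pow_le_fact n : n%:R ^+ n <= expR (1 : R) ^+ n * n`!%:R.
Proof.
elim: n => [|n IH]; first by rewrite !expr0 mul1r.
have [->|n0] := posnP n.
  by rewrite !expr1 mulr1; have := expR_ge1Dx (1 : R); lra.
have nR : n%:R != 0 :> R by rewrite pnatr_eq0 -lt0n.
have step : n.+1%:R ^+ n <= n%:R ^+ n * expR (1 : R).
  have -> : n.+1%:R = n%:R * (1 + n%:R^-1) :> R by rewrite mulrDr mulr1 mulfV // natr1.
  rewrite exprMn ler_wpM2l ?exprn_ge0 //.
  have -> : expR (1 : R) = expR (n%:R^-1) ^+ n by rewrite -expRM_natl mulfV.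
  by rewrite ler_pXn2r ?nnegrE ?expR_ge0 ?addr_ge0 ?invr_ge0 // expR_ge1Dx.
rewrite [leLHS]exprS factS natrM exprS.
have -> : expR 1 * expR 1 ^+ n * (n.+1%:R * n`!%:R) = n.+1%:R * (expR 1 ^+ n * n`!%:R * expR 1) :> R.
  by ring.
rewrite ler_wpM2l //; apply: le_trans step _.
by rewrite ler_wpM2r // expR_ge0.
Qed.

(** Taylor's formula at a point where the derivatives of order < N vanish, by
    descending induction on the order, integrating once at each step. *)
Lemma iter_diff_taylor f z (B : R) e N :
  (forall m t, 0 <= t <= 1 -> differentiable (iter_diff e m f) (z + ofR t *: e)) ->
  (forall m, (m < N)%N -> iter_diff e m f z = 0) ->
  (forall t, 0 <= t <= 1 -> nrm (iter_diff e N f (z + ofR t *: e)) <= B) ->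
  forall j, (j <= N)%N -> forall t, 0 <= t <= 1 ->
    nrm (iter_diff e (N - j) f (z + ofR t *: e)) <= B / j`!%:R * t ^+ j.
Proof.
move=> dD flat DB; elim=> [_ t t01|j IH jN t /andP[t0 t1]].
  by rewrite subn0 fact0 divr1 expr0 mulr1; exact: DB.
have sub x : 0 <= x <= t -> 0 <= x <= 1 by move=> /andP[-> /le_trans]; apply.
have SN : (N - j)%N = (N - j.+1).+1 by rewrite subnSK.
have := @mean_value_pow R (fun t => iter_diff e (N - j.+1) f (z + t *: e)) (B / j`!%:R) t j t0.
rewrite scale0r addr0 flat ?subr0; last by rewrite ltn_subrL /= (leq_ltn_trans _ jN).
have -> : B / j`!%:R * t ^+ j.+1 / j.+1%:R = B / (j.+1)`!%:R * t ^+ j.+1.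
  rewrite factS natrM invfM; ring.
apply => x /sub x01; first by have [] := line_diff (dD (N - j.+1)%N x x01).
rewrite (line_diff (dD (N - j.+1)%N x x01)).2 scale1r.
by have := IH (ltnW jN) x x01; rewrite SN.
Qed.

(** With d = s / (2 N), the estimate of the N-th derivative and Taylor's formula
    give |f(z + e)| <= M (32 exp(1) |e| / s)^N <= M / 2^N for every N. *)
Lemma flat_eq0 f z (s M : R) e : 0 < s -> 64 * expR 1 * nrm e <= s ->
  (forall w, nrm (w - z) < s -> differentiable f w) ->
  (forall w, nrm (w - z) < s -> nrm (f w) <= M) ->
  (forall m, iter_diff e m f z = 0) -> f (z + e) = 0.
Proof.
move=> s0 es df fM flat.
have E1 : 1 <= expR (1 : R) by have := expR_ge1Dx (1 : R); lra.
have e2 : nrm e < s / 2.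
  have e64 : 64 * nrm e <= s.
    by apply: le_trans es; rewrite mulrAC ler_peMr // mulr_ge0 ?nrm_ge0.
  have := nrm_ge0 e; lra.
have M0 : 0 <= M by apply: le_trans (nrm_ge0 _) (fM z _); rewrite subrr nrm0.
have seg t : 0 <= t <= 1 -> nrm (z + ofR t *: e - z) < s / 2.
  move=> /andP[t0 t1]; rewrite add_subl nrmZ nrm_ofR ger0_norm //.
  by apply: le_lt_trans e2; rewrite ler_piMl ?nrm_ge0.
have seg' t : 0 <= t <= 1 -> nrm (z + ofR t *: e - z) < s.
  by move=> /seg h; apply: lt_trans h _; lra.
have key N : (0 < N)%N -> nrm (f (z + e)) <= M * 2^-1 ^+ N.
  move=> N0; have NR : 0 < N%:R :> R by rewrite ltr0n.
  pose d := s / (2 * N%:R); have d0 : 0 < d by rewrite divr_gt0 // mulr_gt0.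
  have sd : s - N%:R * d = s / 2 by rewrite /d; field; rewrite gt_eqF.
  have DB t : 0 <= t <= 1 -> nrm (iter_diff e N f (z + ofR t *: e)) <= M * (16 * nrm e / d) ^+ N.
    by move=> t01; apply: (@iter_diff_bound f z s M d e N d0 df fM); rewrite sd; exact: seg.
  have dD m t : 0 <= t <= 1 -> differentiable (iter_diff e m f) (z + ofR t *: e).
    by move=> t01; apply: (@iter_diff_differentiable f z s e m df); exact: seg'.
  have := iter_diff_taylor dD (fun m _ => flat m) DB (leqnn N) (t := 1).
  rewrite subnn lexx ler01 ofR1 scale1r expr1n mulr1 => /(_ isT) /le_trans; apply.
  rewrite -mulrA ler_wpM2l // ler_pdivrMr ?ltr0n ?fact_gt0 //.
  have -> : 16 * nrm e / d = N%:R * (32 * nrm e / s) by rewrite /d; field; rewrite !gt_eqF.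
  rewrite exprMn.
  apply: le_trans (ler_wpM2r _ (pow_le_fact N)) _.
    by rewrite exprn_ge0 // divr_ge0 ?mulr_ge0 ?nrm_ge0 // ltW.
  rewrite mulrAC -exprMn ler_wpM2r //.
  have q0 : 0 <= 32 * nrm e / s by rewrite divr_ge0 ?mulr_ge0 ?nrm_ge0 // ltW.
  apply: lerXn2r; rewrite ?nnegrE ?invr_ge0 //; first by rewrite mulr_ge0 ?expR_ge0.
  by rewrite mulrA ler_pdivrMr //; lra.
apply/eqP; rewrite -nrm_eq0 eq_le nrm_ge0 andbT.
apply/ler_addgt0Pl => eps eps0; rewrite addr0.
have [N HN] : exists N : nat, M / eps < N%:R.
  by exists (Num.truncn (M / eps)).+1; rewrite truncnS_gt.
apply: le_trans (key N.+1 (ltn0Sn _)) _.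
rewrite exprVn ler_pdivrMr ?exprn_gt0 // mulrC -ler_pdivrMr //.
apply: ltW; apply: lt_le_trans HN _; rewrite -natrX ler_nat.
by apply: leq_trans (leqnSn _) _; apply: ltnW; exact: ltn_expl.
Qed.
End IteratedDerivative.

(** * Persistence of zeros *)

Section ZeroSets.
Variable R : realType.
Local Notation C := (Cx R).

Lemma nrm_lower_bound (F : R -> C) a b : a <= b -> cont_on F a b ->
  (forall t, a <= t <= b -> F t != 0) ->
  exists2 m : R, 0 < m & forall t, a <= t <= b -> m <= nrm (F t).
Proof.
move=> ab cF F0.
have cn : {within `[a, b], continuous (fun t => nrm (F t))}.
  apply: continuous_in_subspaceT => t; rewrite inE /= in_itv /= => tab.
  have /continuous_realP H := cF t tab.
  apply/cvgrPdist_lt => e e0; have [d d0 Hd] := H e e0.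
  apply/nbhs_ballP; exists d => //= s; rewrite /ball /= distrC => /Hd.
  apply: le_lt_trans; rewrite ler_norml.
  have h1 := nrmD (F s - F t) (F t); have h2 := nrmD (F t - F s) (F s).
  rewrite !subrK in h1 h2; rewrite (nrmB (F t)) in h2.
  by apply/andP; split; lra.
have [c cab cmin] := EVT_min ab cn.
exists (nrm (F c)); first by rewrite nrm_gt0 F0 //; move: cab; rewrite in_itv.
by move=> t tab; apply: cmin; rewrite in_itv.
Qed.

(** Compactness of the four sides. *)
Lemma square_lower_bound (F : C -> C) r : 0 < r -> (forall z, supnorm z = r -> cont_at F z) ->
  (forall z, supnorm z = r -> F z != 0) ->
  exists2 m : R, 0 < m & forall z, supnorm z = r -> m <= nrm (F z).
Proof.
move=> r0 cF F0; have rr : - r <= r by lra.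
have Pbd (P : C -> Prop) : (forall z, supnorm z = r -> P z) ->
    forall z, on_rect (- r) r (- r) r z -> P z.
  by move=> H z /(on_square_supnorm r0)/H.
have [cb ct cl cr] := cont_sides rr rr (Pbd _ cF).
have bd := Pbd (fun z => F z != 0) F0.
have [mb mb0 Hb] := nrm_lower_bound rr cb (side_bot rr bd).
have [mt mt0 Ht] := nrm_lower_bound rr ct (side_top rr bd).
have [ml ml0 Hl] := nrm_lower_bound rr cl (side_left rr bd).
have [mr mr0 Hr] := nrm_lower_bound rr cr (side_right rr bd).
exists (Num.min (Num.min mb mt) (Num.min ml mr)); first by rewrite !lt_min mb0 mt0 ml0 mr0.
move=> z zr; have xr : - r <= cre z <= r by rewrite -ler_norml -zr le_max lexx.
have yr : - r <= cim z <= r by rewrite -ler_norml -zr le_max lexx orbT.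
rewrite !ge_min; have [xy|/ltW xy] := leP `|cre z| `|cim z|.
  have : `|cim z| = r by rewrite -zr /supnorm max_r.
  have [y0|/ltW y0] := leP 0 (cim z).
    by rewrite ger0_norm // => yE; rewrite [z]cplx_eta yE Ht ?orbT.
  rewrite ler0_norm // => /(congr1 (fun u => - u)); rewrite opprK => yE.
  by rewrite [z]cplx_eta yE Hb ?orbT.
have : `|cre z| = r by rewrite -zr /supnorm max_l.
have [x0|/ltW x0] := leP 0 (cre z).
  by rewrite ger0_norm // => xE; rewrite [z]cplx_eta xE Hr ?orbT.
rewrite ler0_norm // => /(congr1 (fun u => - u)); rewrite opprK => xE.
by rewrite [z]cplx_eta xE Hl ?orbT.
Qed.

Variable V : normedModType C.
Implicit Types (f g : V -> C) (z h e w p : V).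

(** On the segment, g differs from the affine function with slope dg(p)(e) by at
    most half of that slope. *)
Lemma inj_along g p (r : R) e :
  (forall w, nrm (w - p) < r -> differentiable g w) -> 'd g p e != 0 ->
  (forall w, nrm (w - p) < r -> nrm ('d g w e - 'd g p e) <= nrm ('d g p e) / 2) ->
  forall z (t : C), (forall s, 0 <= s <= 1 -> nrm (z + ofR s *: (t *: e) - p) < r) ->
  g z = g (z + t *: e) -> t = 0.
Proof.
move=> dg k0 near z t seg gE; apply/eqP; rewrite -nrm_eq0.
have cp : continuous ('d g p).
  apply: diff_continuous; apply: dg; rewrite subrr nrm0.
  by have := seg 0; rewrite lexx ler01 => /(_ isT); apply: le_lt_trans; exact: nrm_ge0.
pose G w := g w - 'd g p (w - p).
have dG w (wr : nrm (w - p) < r) := diff_sub_linear p cp (dg w wr).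
have dt w : 'd g w (t *: e) = t * 'd g w e by rewrite linearZ.
have : nrm (G (z + t *: e) - G z) <= nrm t * (nrm ('d g p e) / 2).
  apply: mean_value_dir => s /seg sr; first by have [] := dG _ sr.
  have [_ ->] := dG _ sr; rewrite !dt -mulrBr nrmM.
  by rewrite ler_wpM2l ?nrm_ge0 // near.
have -> : G (z + t *: e) - G z = - (t * 'd g p e).
  rewrite /G -gE [z + _ - p]addrAC linearD dt.
  by set a := 'd g p (z - p); set b := t * _; ring.
rewrite nrmN nrmM => h; rewrite eq_le nrm_ge0 andbT leNgt; apply/negP => tp.
have kp : 0 < nrm ('d g p e) by rewrite nrm_gt0.
move: h; rewrite ler_pM2l //; lra.
Qed.

Lemma segment_near p z h (r : R) : nrm (z - p) < r / 2 -> nrm h < r / 2 ->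
  forall s, 0 <= s <= 1 -> nrm (z + ofR s *: h - p) < r.
Proof.
move=> zr hr s /andP[s0 s1]; rewrite addrAC; apply: le_lt_trans (nrmD _ _) _.
rewrite nrmZ nrm_ofR ger0_norm //.
have : s * nrm h <= nrm h by rewrite ler_piMl ?nrm_ge0.
by move: zr hr; lra.
Qed.

(** If the line through z in the direction e carried no zero of f near p, the
    Cauchy estimate for 1 / f on a square in this line would bound |f(z)| below
    by a fixed fraction of the minimum of |f| on the corresponding square
    through p, whereas f(z) is close to f(p) = 0.  So f has a zero z + t e there;
    it is a zero of g, and so is z, whence t = 0 by [inj_along]. *)
Lemma zeros_persist f g p (s M r : R) e : 0 < s -> 0 < r -> r <= s ->
  (forall w, nrm (w - p) < s -> differentiable f w) ->
  (forall w, nrm (w - p) < s -> nrm (f w) <= M) ->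
  (forall w, nrm (w - p) < r -> differentiable g w) -> 'd g p e != 0 ->
  (forall w, nrm (w - p) < r -> nrm ('d g w e - 'd g p e) <= nrm ('d g p e) / 2) ->
  f p = 0 -> (forall w, nrm (w - p) < r -> f w = 0 -> g w = 0) ->
  \forall z \near p, g z = 0 -> f z = 0.
Proof.
move=> s0 r0 rs df fM dg k0 near fp fg.
have inj z (t : C) : nrm (z - p) < r / 2 -> nrm (t *: e) < r / 2 -> g z = g (z + t *: e) -> t = 0.
  by move=> zr tr; apply: (inj_along dg k0 near); exact: segment_near.
have e0 : e != 0 by apply: contra_neq k0 => ->; rewrite linear0.
have ne : 0 < nrm e by rewrite nrm_gt0.
pose q := r / (8 * nrm e); have q0 : 0 < q by rewrite divr_gt0 // mulr_gt0.
have small (t : C) : supnorm t <= q -> nrm (t *: e) <= r / 4.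
  move=> tq; rewrite nrmZ; apply: le_trans (ler_wpM2r (nrm_ge0 _) (nrm_le_supnorm t)) _.
  apply: le_trans (_ : 2 * q * nrm e <= _); first by rewrite ler_wpM2r ?nrm_ge0 // ler_wpM2l.
  by apply: eq_ler; rewrite /q; field; rewrite gt_eqF.
have small' (t : C) : supnorm t <= q -> nrm (t *: e) < r / 2 by move=> /small; move: r0; lra.
have pp : nrm (p - p) < r / 2 by rewrite subrr nrm0 divr_gt0.
have inr z (t : C) : nrm (z - p) < r / 2 -> supnorm t <= q -> nrm (z + t *: e - p) < r.
  by move=> zr /small' tr; have := segment_near zr tr; move=> /(_ 1); rewrite ofR1 scale1r lexx ler01; apply.
have dft z (t : C) : nrm (z - p) < r / 2 -> supnorm t <= q -> differentiable f (z + t *: e).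
  by move=> zr tq; apply: df; apply: lt_le_trans rs; exact: inr.
have gp : g p = 0 by apply: fg; rewrite // subrr nrm0.
(* the zero of f at p is the only one on its line, hence a positive minimum *)
have [m m0 Hm] : exists2 m : R, 0 < m & forall t : C, supnorm t = q -> m <= nrm (f (p + t *: e)).
  apply: (square_lower_bound q0) => t tq.
    by apply: differentiable_continuous; apply: (line_diff (dft p t pp _)).1; rewrite tq.
  apply/eqP => ft; have tq' : supnorm t <= q by rewrite tq.
  have t0 : t = 0.
    apply: (inj p t pp (small' t tq')); rewrite gp; apply/esym/fg => //; exact: inr.
  by have := q0; rewrite -tq t0 /supnorm cre0 cim0 normr0 maxxx ltxx.
have df' w : nrm (w - p) < 4 * (s / 4) -> differentiable f w by rewrite mulrC divfK //; exact: df.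
have fM' w : nrm (w - p) < 4 * (s / 4) -> nrm (f w) <= M by rewrite mulrC divfK //; exact: fM.
have s40 : 0 < s / 4 by rewrite divr_gt0.
pose L := 16 * M / (s / 4).
have M0 : 0 <= M by apply: le_trans (nrm_ge0 _) (fM p _); rewrite subrr nrm0.
have L0 : 0 <= L by rewrite divr_ge0 ?mulr_ge0 // ltW.
pose d := Num.min (r / 4) (m / 32 / (L + 1)).
have L1 : 0 < L + 1 by rewrite ltr_wpDl.
have d0 : 0 < d by rewrite lt_min !divr_gt0.
apply/nbhs_nrmP; exists d => // h; rewrite lt_min => /andP[hr]; rewrite ltr_pdivlMr // => hm gz.
have hr2 : nrm (p + h - p) < r / 2 by rewrite add_subl; move: r0 hr; lra.
have hL : L * nrm h < m / 32.
  by apply: le_lt_trans hm; rewrite mulrC ler_wpM2l ?nrm_ge0 // lerDl.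
have lip (t : C) : supnorm t <= q -> nrm (f (p + t *: e + h) - f (p + t *: e)) <= L * nrm h.
  move=> tq; have te := small t tq; apply: (holo_lipschitz s40 df' fM').
    by rewrite add_subl; move: te r0 rs; lra.
  rewrite add_subl2; apply: le_lt_trans (nrmD _ _) _; move: te r0 rs hr; lra.
have [t [tq ft]] : exists t : C, supnorm t <= q /\ f (p + h + t *: e) = 0.
  apply: contrapT => nex.
  have nz (t : C) : supnorm t <= q -> f (p + h + t *: e) != 0.
    by move=> tq; apply/eqP => ft; apply: nex; exists t.
  have := @cauchy_value_bound R (fun t => (f (p + h + t *: e))^-1) q (2 / m) q0.
  move=> H; have : nrm (f (p + h + (0 : C) *: e))^-1 <= 8 * (2 / m).
    apply: H => t tq.
      apply: differentiableV; last exact: nz.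
      exact: (line_diff (dft _ t hr2 tq)).1.
    have tq' : supnorm t <= q by rewrite tq.
    have low : m / 2 <= nrm (f (p + h + t *: e)).
      have h1 := Hm t tq; have h2 := lip t tq'.
      have h5 := nrmD (f (p + t *: e + h)) (f (p + t *: e) - f (p + t *: e + h)).
      rewrite addrC subrK [nrm (_ - f (p + t *: e + h))]nrmB in h5.
      rewrite [p + h + _]addrAC; move: h1 h2 h5 hL m0; clear; lra.
    rewrite nrmV -[2 / m]invrK invf_div lef_pV2 ?posrE //.
      by apply: lt_le_trans low; rewrite divr_gt0.
    by rewrite divr_gt0.
  rewrite nrmV scale0r addr0.
  have q00 : supnorm (0 : C) <= q by rewrite /supnorm cre0 cim0 normr0 maxxx ltW.
  have := lip 0 q00; rewrite scale0r addr0 fp subr0.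
  have fpos : 0 < nrm (f (p + h)) by rewrite nrm_gt0; have := nz 0 q00; rewrite scale0r addr0.
  move=> fle; rewrite leNgt => /negP; apply.
  have -> : 8 * (2 / m) = (m / 16)^-1 by field; rewrite gt_eqF.
  by rewrite ltf_pV2 ?posrE ?divr_gt0 //; move: fle hL m0; clear; lra.
have t0 : t = 0.
  apply: (inj (p + h) t hr2 (small' t tq)); rewrite gz; apply/esym/fg => //; exact: inr.
by move: ft; rewrite t0 scale0r addr0.
Qed.
End ZeroSets.

(** * Zero sets of holomorphic functions have codimension at most one *)

Section Hypersurface.
Variables (R : realType) (n : nat).
Local Notation C := (Cx R).
Local Notation Cn := 'rV[C]_n.

Lemma submanifold_codim0 (A : set Cn) p : (\forall z \near p, A z) -> contains_submanifold A 0 p.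
Proof.
move=> nA; exists (fun=> 0); split => //.
- by apply: filterE => z; exact: differentiable_cst.
- by apply/eqP; rewrite -leqn0 rank_leq_col.
- by apply: filterS nA => z Az _.
Qed.

Lemma submanifold_codim1 (A : set Cn) (g : Cn -> C) p e :
  (\forall z \near p, differentiable g z) -> g p = 0 -> 'd g p e != 0 ->
  (\forall z \near p, g z = 0 -> A z) -> contains_submanifold A 1 p.
Proof.
move=> dg gp dge gA; pose u : 'rV[C]_1 := const_mx 1.
have uE (a : C) : a *: u = 0 -> a = 0 by move=> /rowP/(_ 0); rewrite !mxE mulr1.
exists (fun z => g z *: u); split.
- by apply: filterS dg => z dgz; exact: differentiableZl.
- by rewrite gp scale0r.
- apply/eqP; rewrite eqn_leq rank_leq_col lt0n mxrank_eq0 /=.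
  apply: contra_neq dge => J0; apply: uE.
  have dgp : differentiable g p by exact: nbhs_singleton dg.
  have := congr1 (fun M => e *m M) J0; rewrite mulmx0 /jacobian mul_rV_lin1 => <-.
  exact: esym (congr1 (fun h : Cn -> 'rV[C]_1 => h e) (diffZl u dgp)).
- by apply: filterS gA => z gA /uE.
Qed.

(** Either f is zero near 0, or the argument on a zero of minimal order along a
    direction e applies. *)
Lemma zeros_codim_le1 (f : Cn -> C) (A : set Cn) :
  (\forall z \near (0 : Cn), differentiable f z) -> f 0 = 0 ->
  (\forall z \near (0 : Cn), f z = 0 -> A z) -> ~ codim_ge A 2 0.
Proof.
move=> df f0 fA cA.
have cf : {for 0, continuous f}.
  by apply: differentiable_continuous; exact: nbhs_singleton df.
have bf : \forall z \near (0 : Cn), nrm (f z) <= 1.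
  have /continuous_nrmP/(_ _ ltr01)[d d0 Hd] := cf.
  by apply/nbhs_nrmP; exists d => // h /Hd; rewrite f0 subr0 => /ltW.
have /nbhs_nrmP[s s0 H] : \forall z \near (0 : Cn), (differentiable f z /\ nrm (f z) <= 1) /\
    ((f z = 0 -> A z) /\ forall d, contains_submanifold A d z -> (2 <= d)%N).
  exact: filterI (filterI df bf) (filterI fA cA).
have dfs z : nrm z < s -> differentiable f z by move=> /H[[]]; rewrite add0r.
have bfs z : nrm z < s -> nrm (f z) <= 1 by move=> /H[[]]; rewrite add0r.
have fAs z : nrm z < s -> f z = 0 -> A z by move=> /H[_ []]; rewrite add0r.
have cAs z : nrm z < s -> forall d, contains_submanifold A d z -> (2 <= d)%N.
  by move=> /H[_ [_]]; rewrite add0r.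
have s00 : nrm (0 : Cn) < s by rewrite nrm0.
pose c := 64 * expR (1 : R); have cp : 0 < c by rewrite mulr_gt0 // expR_gt0.
(* c is the constant of flat_eq0 *)
have [ze|/existsNP[e /not_implyP[es fe]]] :=
    pselect (forall e : Cn, c * nrm e <= s -> f e = 0).
  have : contains_submanifold A 0 0.
    apply: submanifold_codim0; apply/nbhs_nrmP; exists (Num.min s (s / c)).
      by rewrite lt_min s0 divr_gt0.
    move=> h; rewrite add0r lt_min ltr_pdivlMr // => /andP[hs hc]; apply: fAs => //.
    by apply: ze; rewrite mulrC ltW.
  by move=> /(cAs 0 s00).
have df0 w : nrm (w - 0) < s -> differentiable f w by rewrite subr0; exact: dfs.
have bf0 w : nrm (w - 0) < s -> nrm (f w) <= 1 by rewrite subr0; exact: bfs.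
have [N DN] : exists N, iter_diff e N f 0 != 0.
  apply: contrapT => nex; apply: fe; rewrite -[e]add0r.
  apply: (@flat_eq0 R _ f 0 s 1 e s0 es df0 bf0) => m.
  by apply/eqP; apply: contrapT => /negP h; apply: nex; exists m.
(* m is the least order along e of a zero of f close to 0; N bounds it *)
pose P m := `[< exists p, [/\ nrm p < s / 2, f p = 0 & iter_diff e m f p != 0] >].
have exP : exists m, P m by exists N; apply/asboolP; exists 0; rewrite nrm0 divr_gt0.
have [m /asboolP[p [ps fp Dp]] minm] := ex_minnP exP.
have flat q j : nrm q < s / 2 -> f q = 0 -> (j < m)%N -> iter_diff e j f q = 0.
  move=> qs fq jm; apply/eqP; apply: contraLR jm => Dq; rewrite -leqNgt.
  by apply: minm; apply/asboolP; exists q.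
case: m => [|m] in Dp minm flat *; first by move: Dp; rewrite /iter_diff /= fp eqxx.
pose g := iter_diff e m f.
have dD j w : nrm w < s -> differentiable (iter_diff e j f) w.
  by move=> ws; apply: (@iter_diff_differentiable R _ f 0 s e j df0); rewrite subr0.
have s2 : 0 < s / 2 by rewrite divr_gt0.
have sub w (r : R) : r <= s / 2 -> nrm (w - p) < r -> nrm w < s.
  move=> rs wr; rewrite -[w](subrK p); apply: le_lt_trans (nrmD _ _) _.
  by move: rs wr ps; lra.
have pss : nrm p < s by apply: sub (lexx _) _; rewrite subrr nrm0.
have cD : {for p, continuous (iter_diff e m.+1 f)}.
  by apply: differentiable_continuous; exact: dD.
have kp : 0 < nrm (iter_diff e m.+1 f p) / 2 by rewrite divr_gt0 // nrm_gt0.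
have /continuous_nrmP/(_ _ kp)[d d0 Hd] := cD.
pose r := Num.min d (s / 2 - nrm p).
have r0 : 0 < r by rewrite lt_min d0 subr_gt0.
have rs : r <= s / 2 by rewrite ge_min; apply/orP; right; rewrite lerBlDr lerDl nrm_ge0.
have gp : g p = 0 by apply: flat.
have : contains_submanifold A 1 p.
  apply: (submanifold_codim1 (g := g) (e := e)) => //.
    apply: (near_ball (z := 0) (s := s)); first by rewrite subr0.
    by move=> y; rewrite subr0; exact: dD.
  have pers : \forall z \near p, g z = 0 -> f z = 0.
    apply: (@zeros_persist R _ f g p (s / 2) 1 r e s2 r0 rs).
    - by move=> w /(sub w _ (lexx _)); exact: dfs.
    - by move=> w /(sub w _ (lexx _)); exact: bfs.
    - by move=> w /(sub w _ rs); exact: dD.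
    - exact: Dp.
    - move=> w; rewrite lt_min => /andP[wd _]; apply: ltW.
      by have := Hd (w - p) wd; rewrite [p + _]addrC subrK.
    - exact: fp.
    - move=> w wr fw; apply: flat => //.
      rewrite -[w](subrK p); apply: le_lt_trans (nrmD _ _) _.
      by move: wr; rewrite lt_min => /andP[_]; lra.
  have nA : \forall z \near p, f z = 0 -> A z.
    apply: (near_ball (z := 0) (s := s)); first by rewrite subr0.
    by move=> y; rewrite subr0; exact: fAs.
  by apply: filterS (filterI pers nA) => z [gf fAz] /gf.
by move=> /(cAs p pss).
Qed.
End Hypersurface.

(** * Forms given by determinants *)

Section LinearAlgebra.
Variable K : numFieldType.

Definition unit_rows m n (J : {ffun 'I_m -> 'I_n}) : 'M[K]_(m, n) :=
  \matrix_(i, j) (j == J i)%:R.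

Definition coord_prod m n (J : {ffun 'I_m -> 'I_n}) (U : 'M[K]_(m, n)) : K :=
  \prod_i U i (J i).

Lemma unit_rows_mul m n p (J : {ffun 'I_m -> 'I_n}) (L : 'M[K]_(n, p)) i t :
  (unit_rows J *m L) i t = L (J i) t.
Proof.
rewrite mxE (bigD1 (J i)) //= mxE eqxx mul1r big1 ?addr0 // => j jJ.
by rewrite mxE (negbTE jJ) mul0r.
Qed.

(** Multilinear expansion in the rows of U; the unit rows pick rows of L. *)
Lemma det_mul_expand m n (U : 'M[K]_(m, n)) (L : 'M[K]_(n, m)) :
  \det (U *m L) = \sum_(J : {ffun 'I_m -> 'I_n}) coord_prod J U * \det (unit_rows J *m L).
Proof.
rewrite /determinant.
transitivity (\sum_(s : {perm 'I_m}) \sum_(J : {ffun 'I_m -> 'I_n})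
   (-1) ^+ s * (coord_prod J U * \prod_i L (J i) (s i))).
  apply: eq_bigr => s _; rewrite -big_distrr /=; congr (_ * _).
  under eq_bigr do rewrite mxE.
  rewrite bigA_distr_bigA /=; apply: eq_bigr => J _.
  by rewrite big_split.
rewrite exchange_big /=; apply: eq_bigr => J _.
rewrite big_distrr /=; apply: eq_bigr => s _.
by rewrite mulrCA; congr (_ * (_ * _)); apply: eq_bigr => i _; rewrite unit_rows_mul.
Qed.

(** The contraction by the q-form w of the (q + 1)-vector u_0 /\ ... /\ u_q made
    of the rows of U: a combination of these rows that lies in the kernel of w
    when w is decomposable. *)
Definition contract q n (w : 'M[K]_(q, n) -> K) (U : 'M[K]_(q.+1, n)) : 'rV[K]_n :=
  \sum_(j < q.+1) ((-1) ^+ j * w (row' j U)) *: row j U.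

Section DetForm.
Variables (q n : nat) (w : 'M[K]_(q, n) -> K) (L : 'M[K]_(n, q)).
Hypothesis wL : forall A, w A = \det (A *m L).

Lemma row'_mul m p (j : 'I_m) (A : 'M[K]_(m, n)) (B : 'M[K]_(n, p)) :
  row' j (A *m B) = row' j A *m B.
Proof. by apply/matrixP => a b; rewrite !mxE; apply: eq_bigr => c _; rewrite !mxE. Qed.

(** Laplace expansion along the first column. *)
Lemma contract_mul p (U : 'M[K]_(q.+1, n)) (B : 'M[K]_(n, p)) t :
  (contract w U *m B) 0 t = \det (row_mx (col t (U *m B)) (U *m L) : 'M[K]_(1 + q)).
Proof.
rewrite (expand_det_col _ (lshift q (ord0 : 'I_1))) /contract mulmx_suml summxE.
apply: eq_bigr => j _; rewrite -scalemxAl [LHS]mxE -row_mul.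
rewrite row_mxEl [col _ _ _ _]mxE [in LHS]mxE mulrC; congr (_ * _); rewrite /cofactor addn0 wL; congr (_ * \det _).
rewrite -[LHS](row'_mul j U L); apply/matrixP => a b; rewrite !mxE.
case: splitP => [c /= | c /= bc]; first by rewrite ord1 /bump leq0n.
rewrite !mxE; apply: eq_bigr => x _; congr (_ * L x _).
by apply: val_inj; move: bc; rewrite /bump leq0n add1n => -[].
Qed.

(** By [contract_mul] each entry is a determinant with a repeated column. *)
Lemma contract_mulL U : contract w U *m L = 0.
Proof.
apply/rowP => t; rewrite contract_mul mxE -det_tr.
apply: (determinant_alternate (i1 := lshift q (ord0 : 'I_1)) (i2 := rshift 1 t)) => [|j].
  by rewrite eq_lrshift.
by rewrite [LHS]mxE [RHS]mxE row_mxEl row_mxEr mxE.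
Qed.

Lemma contractE U s : contract w U 0 s = \det (U *m row_mx (delta_mx s 0) L : 'M[K]_(1 + q)).
Proof.
rewrite -[contract w U]mulmx1 contract_mul mulmx1 mul_mx_row; congr (\det (row_mx _ _)).
by apply/colP => j; rewrite -colE !mxE.
Qed.

Lemma contract_expand U :
  contract w U = \sum_(J : {ffun 'I_q.+1 -> 'I_n}) coord_prod J U *: contract w (unit_rows J).
Proof.
apply/rowP => s; rewrite contractE det_mul_expand summxE; apply: eq_bigr => J _.
by rewrite mxE contractE.
Qed.

Lemma form_expand A : w A = \sum_(J : {ffun 'I_q -> 'I_n}) coord_prod J A * w (unit_rows J).
Proof. by rewrite wL det_mul_expand; apply: eq_bigr => J _; rewrite wL. Qed.

(** By [contractE] each coordinate is a determinant whose rows are indexed by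
    those of U. *)
Lemma contract_tperm U a b : a != b ->
  contract w (row_perm (tperm a b) U) = - contract w U.
Proof.
move=> ab; apply/rowP => s; rewrite mxE !contractE row_permE -mulmxA det_mulmx det_perm.
by rewrite odd_tperm ab expr1 mulN1r.
Qed.
End DetForm.

(** All terms but the first one contain w evaluated on x and other vectors. *)
Lemma contract_col_mx q n (w : 'M[K]_(q.+1, n) -> K) (x : 'rV[K]_n) (A : 'M[K]_(q.+1, n)) :
  (forall B : 'M[K]_(q, n), w (col_mx x B) = 0) ->
  contract w (col_mx x A : 'M[K]_(1 + q.+1, n)) = w A *: x.
Proof.
move=> wx; rewrite /contract big_ord_recl expr0 mul1r big1 ?addr0.
  congr (w _ *: _).
    apply/matrixP => i j; rewrite !mxE.
    case: splitP => [c /= | c /= bc]; first by rewrite ord1 /bump leq0n.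
    by congr (A _ _); apply: val_inj; move: bc; rewrite /bump leq0n add1n => -[].
  apply/rowP => j; rewrite mxE -(col_mxEu x A 0 j).
  by congr (fun_of_matrix _ _ _); exact: val_inj.
move=> j _; rewrite [w _](_ : _ = 0) ?mulr0 ?scale0r // -(wx (row' j A)); congr w.
apply/matrixP => a b; rewrite [LHS]mxE.
have -> : (col_mx x (row' j A)) a b = (col_mx x (row' j A) : 'M[K]_(1 + q, n)) a b by [].
case: (splitP (a : 'I_(1 + q))) => [c ac|c ac].
  have -> : a = lshift q c by apply: val_inj.
  have -> : lift (lift ord0 j) (lshift q c) = lshift q.+1 c :> 'I_(1 + q.+1).
    by apply: val_inj; rewrite /= ord1 /bump /=.
  by rewrite (col_mxEu x A); exact: esym (col_mxEu x (row' j A) _ _).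
have -> : a = rshift 1 c by apply: val_inj.
have -> : lift (lift ord0 j) (rshift 1 c) = rshift 1 (lift j c) :> 'I_(1 + q.+1).
  by apply: val_inj; rewrite /= /bump /= !add1n ltnS addnS.
rewrite (col_mxEd x A); apply: etrans (esym (col_mxEd x (row' j A) c b)).
by rewrite [RHS]mxE.
Qed.

(** If w A <> 0 for some A, the rows of E are killed by L, since
    contract w (x, A) = w A *: x is; as E and U span, the rank of L is that of
    U *m L, which is not full because its determinant w U is zero. *)
Lemma det_form_eq0 q n r (w : 'M[K]_(q.+1, n) -> K) (L : 'M[K]_(n, q.+1))
    (E : 'M[K]_(r, n)) (U : 'M[K]_(q.+1, n)) (B : 'M[K]_(n, r + q.+1)) :
  (forall A, w A = \det (A *m L)) ->
  (forall i (A : 'M[K]_(q, n)), w (col_mx (row i E) A) = 0) ->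
  B *m col_mx E U \in unitmx -> w U = 0 -> forall A, w A = 0.
Proof.
move=> wL wE uB wU A; apply/eqP; apply: contraT => wA.
have EL : E *m L = 0.
  apply/row_matrixP => i; rewrite row_mul row0.
  have := contract_mulL wL (col_mx (row i E) A : 'M[K]_(1 + q.+1, n)).
  rewrite contract_col_mx // -scalemxAl => /eqP; rewrite scaler_eq0 (negbTE wA) => /eqP; exact.
have LU : (\rank L <= \rank (U *m L))%N.
  have LE : L = invmx (B *m col_mx E U) *m (B *m (col_mx E U *m L)).
    by rewrite (mulmxA B) mulKmx.
  rewrite {1}LE mul_col_mx EL.
  apply: leq_trans (mxrankM_maxr _ _) _; apply: leq_trans (mxrankM_maxr _ _) _.
  by apply: mxrankS; rewrite col_mx_sub sub0mx submx_refl.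
have rA : \rank (A *m L) = q.+1.
  by apply/eqP; rewrite -/(row_free _) row_free_unit unitmxE -wL unitfE.
have : \rank (U *m L) = q.+1.
  apply/eqP; rewrite eqn_leq rank_leq_row -{1}rA.
  exact: leq_trans (mxrankM_maxr _ _) LU.
by move=> /eqP; rewrite -/(row_free _) row_free_unit unitmxE -wL unitfE wU eqxx.
Qed.

(** U spans a complement of the row space of E, padded to q rows. *)
Lemma completion r n q (E : 'M[K]_(r, n)) : (n <= \rank E + q)%N ->
  exists (U : 'M[K]_(q, n)) (B : 'M[K]_(n, r + q)), B *m col_mx E U = 1%:M.
Proof.
move=> nE; pose M := (E^C)%MS; have rM : (\rank M <= q)%N by rewrite mxrank_compl leq_subLR.
pose U : 'M[K]_(q, n) := pid_mx (\rank M) *m row_base M.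
have MU : (M <= U)%MS.
  have -> : (M <= U)%MS = (row_base M <= U)%MS by rewrite eq_row_base.
  apply/submxP; exists (pid_mx (\rank M)); rewrite mulmxA pid_mx_id // pid_mx_1 mul1mx //.
have full : (1%:M <= col_mx E U)%MS.
  have := addsmx_compl_full E; rewrite -sub1mx => /submx_trans; apply.
  by rewrite -addsmxE; apply: addsmxS.
by have /submxP[B BE] := full; exists U, B.
Qed.
End LinearAlgebra.

(** * Division by a tangent field with a unit coordinate *)

Section Germs.
Variables (K : numFieldType) (n : nat).
Local Notation Kn := 'rV[K]_n.

Lemma differentiable_bigsum (W : normedModType K) (I : Type) (s : seq I) (F : I -> Kn -> W) z :
  (forall i, differentiable (F i) z) -> differentiable (fun x => \sum_(i <- s) F i x) z.
Proof.
move=> dF; elim: s => [|i s IH].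
  rewrite (_ : (fun _ => _) = cst 0); first exact: differentiable_cst.
  by apply/funext => x; rewrite big_nil.
rewrite (_ : (fun _ => _) = F i + (fun x => \sum_(j <- s) F j x)).
  exact: differentiableD.
by apply/funext => x; rewrite big_cons.
Qed.

Lemma differentiable_bigprod (I : Type) (s : seq I) (F : I -> Kn -> K) z :
  (forall i, differentiable (F i) z) -> differentiable (fun x => \prod_(i <- s) F i x) z.
Proof.
move=> dF; elim: s => [|i s IH].
  rewrite (_ : (fun _ => _) = cst 1); first exact: differentiable_cst.
  by apply/funext => x; rewrite big_nil.
rewrite (_ : (fun _ => _) = F i * (fun x => \prod_(j <- s) F j x)).
  exact: differentiableM.
by apply/funext => x; rewrite big_cons.
Qed.

Lemma differentiable_mul (f g : Kn -> K) z : differentiable f z -> differentiable g z ->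
  differentiable (fun x => f x * g x) z.
Proof. by move=> df dg; exact: (differentiableM df dg). Qed.

Lemma differentiable_cmul (a : K) (f : Kn -> K) z : differentiable f z ->
  differentiable (fun x => a * f x) z.
Proof. by move=> df; apply: differentiable_mul => //; exact: differentiable_cst. Qed.

Lemma differentiable_entry (f : Kn -> Kn) z j : differentiable f z ->
  differentiable (fun x => f x 0 j) z.
Proof.
by move=> df; exact: (differentiable_comp df (differentiable_coord (f z) 0 j)).
Qed.

Lemma near_neq0 (f : Kn -> K) : differentiable f (0 : Kn) -> f 0 != 0 ->
  \forall z \near (0 : Kn), f z != 0.
Proof.
move=> /differentiable_continuous/cvgrPdist_lt/(_ `|f 0|); rewrite normr_gt0 => H f0.
by apply: filterS (H f0) => z; apply: contraTneq => ->; rewrite subr0 ltxx.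
Qed.

Lemma near_forall (I : finType) (P : I -> Kn -> Prop) :
  (forall i, \forall z \near (0 : Kn), P i z) -> \forall z \near (0 : Kn), forall i, P i z.
Proof. by move=> nP; exact: (@filter_forall Kn I P (nbhs (0 : Kn)) _ nP). Qed.

(** On one row, multilinearity is linearity. *)
Lemma linear_covector (f : 'M[K]_(1, n) -> K) : Defs.multilinear f ->
  forall v, f v = \sum_s v 0 s * f (delta_mx 0 s).
Proof.
move=> mf.
have lin a x y : f (a *: x + y) = a * f x + f y.
  apply: (mf 0); rewrite ?row_thin_mx; try by apply/matrixP => -[].
  by rewrite linearP.
have f0 : f 0 = 0.
  have := lin 1 0 0; rewrite scaler0 addr0 mul1r => /esym/eqP.
  by rewrite -[X in _ == X]addr0 (inj_eq (addrI _)) => /eqP.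
move=> v; rewrite [v in LHS]row_sum_delta; elim: (index_enum _) => [|s l IH].
  by rewrite !big_nil.
by rewrite !big_cons lin IH.
Qed.

Section Form.
Variables (q : nat) (w : qform K n q.+1).
Hypothesis dw : defines_distribution w.

Lemma det_form_near : \forall z \near (0 : Kn),
  exists L : 'M[K]_(n, q.+1), forall A, w z A = \det (A *m L).
Proof.
case: dw => _ _ dec; apply: filterS dec => z dec.
have [sz|/dec[eta [heta /nbhs_singleton wE]]] := pselect (sing w z).
  by exists 0 => A; rewrite mulmx0 det0; exact: sz.
exists (\matrix_(s, i) eta i z (delta_mx 0 s)) => A.
rewrite wE /wedge1 -det_tr; congr (\det _); apply/matrixP => j i; rewrite !mxE.
have [[meta _] _] := nbhs_singleton (heta i).
rewrite (linear_covector meta); apply: eq_bigr => s _; by rewrite !mxE.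
Qed.

Definition contraction_field (U : 'M[K]_(q.+2, n)) (z : Kn) : Kn := contract (w z) U.

(** The contraction is killed by L, so the determinant defining the interior
    product has a zero row. *)
Lemma contraction_tangent U : tangent_field w (contraction_field U).
Proof.
split.
  case: dw => hw _ _; apply: filterS hw => z [_ dz].
  apply: differentiable_bigsum => j; apply: differentiableZl.
  by apply: differentiable_cmul; exact: dz.
apply: filterS det_form_near => z [L wL] A.
rewrite /interior_product wL.
have -> : (col_mx (contraction_field U z) A : 'M[K]_(1 + q, n)) *m L =
    col_mx (0 : 'rV[K]_q.+1) ((A : 'M[K]_(q, n)) *m L).
  by rewrite mul_col_mx (contract_mulL wL).
rewrite (expand_det_row _ (lshift q (ord0 : 'I_1))) big1 // => j _.
by rewrite (@col_mxEu K 1 q) mxE mul0r.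
Qed.

Variables (r : nat) (e : 'I_r -> Kn -> Kn).
Hypothesis gen : forall v, tangent_field w v ->
  exists a : 'I_r -> Kn -> K, (forall i, holomorphic_near (a i) 0) /\
    \forall z \near (0 : Kn), v z = \sum_(i < r) a i z *: e i z.
Hypothesis indep : forall a : 'I_r -> Kn -> K, (forall i, holomorphic_near (a i) 0) ->
  (\forall z \near (0 : Kn), \sum_(i < r) a i z *: e i z = 0) ->
  forall i, \forall z \near (0 : Kn), a i z = 0.

Definition coord_form m (c : {ffun 'I_m -> 'I_n} -> K) (U : 'M[K]_(m, n)) : K :=
  \sum_(J : {ffun 'I_m -> 'I_n}) coord_prod J U * c J.

Lemma coord_prod_eq m (J : {ffun 'I_m -> 'I_n}) (i : 'I_m) (A D : 'M[K]_(m, n)) :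
  row' i A = row' i D ->
  \prod_(l | l != i) A l (J l) = \prod_(l | l != i) D l (J l).
Proof.
move=> AD; apply: eq_bigr => l; rewrite eq_sym => /unlift_some[l' El _].
by have := congr1 (fun M : 'M[K]_(m.-1, n) => M l' (J l)) AD; rewrite !mxE -El.
Qed.

Lemma coord_form_multilinear m (c : {ffun 'I_m -> 'I_n} -> K) : Defs.multilinear (coord_form c).
Proof.
move=> i a A B D rA rB rD; rewrite /coord_form big_distrr -big_split /=.
apply: eq_bigr => J _; rewrite mulrA -mulrDl; congr (_ * _).
rewrite /coord_prod (bigD1 i) //= [in RHS](bigD1 i) //= [X in _ = _ + X](bigD1 i) //=.
rewrite (coord_prod_eq J rA) (coord_prod_eq J rB) mulrA -mulrDl; congr (_ * _).
by have := congr1 (fun M : 'rV[K]_n => M 0 (J i)) rD; rewrite !mxE.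
Qed.

Definition ffun_tperm m (J : {ffun 'I_m -> 'I_n}) a b : {ffun 'I_m -> 'I_n} :=
  [ffun i => J (tperm a b i)].

(** Exchanging two equal rows of A changes the sign of the sum, by reindexing. *)
Lemma coord_form_alternating m (c : {ffun 'I_m -> 'I_n} -> K) :
  (forall J a b, a != b -> c (ffun_tperm J a b) = - c J) -> Defs.alternating (coord_form c).
Proof.
move=> cN; split=> [|a b A ab Aab]; first exact: coord_form_multilinear.
have inv J : ffun_tperm (ffun_tperm J a b) a b = J.
  by apply/ffunP => i; rewrite !ffunE tpermK.
have TN : coord_form c A = - coord_form c A.
  rewrite {1}/coord_form (reindex_inj (h := fun J => ffun_tperm J a b)); last exact: (inv_inj (f := fun J => ffun_tperm J a b) inv).
  rewrite -sumrN; apply: eq_bigr => J _; rewrite cN // mulrN; congr (- (_ * _)).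
  rewrite /coord_prod (reindex_inj (h := tperm a b)); last exact: perm_inj.
  apply: eq_bigr => i _; rewrite ffunE tpermK.
  have [->|->|] := tpermP a b i => //.
    by have := congr1 (fun M : 'rV[K]_n => M 0 (J a)) Aab; rewrite !mxE.
  by have := congr1 (fun M : 'rV[K]_n => M 0 (J b)) Aab; rewrite !mxE.
apply/eqP; have : coord_form c A *+ 2 == 0 by rewrite mulr2n {2}TN subrr.
by rewrite mulrn_eq0.
Qed.

Lemma coord_prod_col_mx m (J : {ffun 'I_(1 + m) -> 'I_n}) (x : Kn) (A : 'M[K]_(m, n)) :
  coord_prod J (col_mx x A) = x 0 (J (lshift m 0)) * \prod_(l < m) A l (J (rshift 1 l)).
Proof.
rewrite /coord_prod big_split_ord /= big_ord1 col_mxEu; congr (_ * _).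
by apply: eq_bigr => l _; rewrite col_mxEd.
Qed.

Lemma differentiable_coord_prod m (J : {ffun 'I_(1 + m) -> 'I_n}) (X : Kn -> Kn)
    (A : 'M[K]_(m, n)) z : differentiable X z ->
  differentiable (fun x => coord_prod J (col_mx (X x) A)) z.
Proof.
move=> dX; rewrite (_ : (fun _ => _) = (fun x => X x 0 (J (lshift m 0)) *
   \prod_(l < m) A l (J (rshift 1 l)))); last by apply/funext => x; rewrite coord_prod_col_mx.
apply: differentiable_mul; last exact: differentiable_cst.
exact: differentiable_entry.
Qed.

Lemma coord_form_expand m (c : {ffun 'I_(1 + m) -> 'I_n} -> K) (x : Kn) (A : 'M[K]_(m, n)) :
  coord_form c (col_mx x A) =
  \sum_(J : {ffun 'I_m -> 'I_n}) coord_prod J A * coord_form c (col_mx x (unit_rows K J)).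
Proof.
rewrite /coord_form; under [RHS]eq_bigr do rewrite big_distrr.
rewrite exchange_big /=; apply: eq_bigr => J _.
under [RHS]eq_bigr do rewrite mulrA; rewrite -big_distrl; congr (_ * _).
pose J0 : {ffun 'I_m -> 'I_n} := [ffun l => J (rshift 1 l)].
rewrite (bigD1 J0) //= big1 ?addr0 => [|J' J'0].
  rewrite !coord_prod_col_mx [X in _ = _ * (_ * X)]big1 ?mulr1 => [|l _].
    by rewrite mulrC; congr (_ * _); apply: eq_bigr => l _; rewrite ffunE.
  by rewrite mxE ffunE eqxx.
rewrite coord_prod_col_mx.
have [l Jl] : exists l, J' l != J0 l.
  apply: contrapT => nex; move/negP: J'0; apply; apply/eqP/ffunP => l.
  by apply/eqP; apply: contrapT => /negP h; apply: nex; exists l.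
rewrite (bigD1 l) //= mxE; move: Jl; rewrite ffunE eq_sym => /negbTE ->.
by rewrite mul0r !mulr0.
Qed.

Lemma unit_rows_tperm m (J : {ffun 'I_m -> 'I_n}) a b :
  unit_rows K (ffun_tperm J a b) = row_perm (tperm a b) (unit_rows K J).
Proof. by apply/matrixP => i j; rewrite !mxE ffunE. Qed.

(** The form is T i0 / a i0, where T i z U is the e_i-coordinate at z of the
    contraction of w by U. *)
Lemma divides_unit_coord (X : Kn -> Kn) (a : 'I_r -> Kn -> K) i0 :
  holomorphic_near X 0 -> annihilates X w -> (forall i, holomorphic_near (a i) 0) ->
  (\forall z \near (0 : Kn), X z = \sum_(i < r) a i z *: e i z) ->
  a i0 0 != 0 -> divides X w.
Proof.
move=> hX annX ha XE a0.
have [c cP] := choice (fun J : {ffun 'I_q.+2 -> 'I_n} => gen (contraction_tangent (unit_rows K J))).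
pose T i z := coord_form (fun J => c J i z).
have hc J i : holomorphic_near (c J i) 0 by have [] := cP J.
have cE : \forall z \near (0 : Kn), forall J,
    contract (w z) (unit_rows K J) = \sum_i c J i z *: e i z.
  by apply: near_forall => J; have [] := cP J.
have TE : \forall z \near (0 : Kn), forall U, \sum_i T i z U *: e i z = contract (w z) U.
  apply: filterS (filterI cE det_form_near) => z [cz [L wL]] U.
  rewrite (contract_expand wL).
  transitivity (\sum_i \sum_J coord_prod J U *: (c J i z *: e i z)).
    by apply: eq_bigr => i _; rewrite scaler_suml; apply: eq_bigr => J _; rewrite scalerA.
  by rewrite exchange_big /=; apply: eq_bigr => J _; rewrite -scaler_sumr cz.
(* coordinates inherit the antisymmetry of the contraction *)
have cN : \forall z \near (0 : Kn), forall J x y i, x != y -> c (ffun_tperm J x y) i z = - c J i z.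
  apply: near_forall => J; apply: near_forall => x; apply: near_forall => y.
  have [->|xy] := eqVneq x y; first by apply: filterE => z i.
  apply: near_forall => i.
  have h : \forall z \near (0 : Kn), c (ffun_tperm J x y) i z + c J i z = 0.
    apply: (indep (a := fun i z => c (ffun_tperm J x y) i z + c J i z)) => [j|].
      by apply: filterS (filterI (hc (ffun_tperm J x y) j) (hc J j)) => z [d1 d2];
         exact: (differentiableD d1 d2).
    apply: filterS (filterI cE det_form_near) => z [cz [L wL]].
    under eq_bigr do rewrite scalerDl; rewrite big_split /= -!cz unit_rows_tperm.
    by rewrite (contract_tperm wL) // addNr.
  by apply: filterS h => z /eqP; rewrite addr_eq0 => /eqP E _.
(* comparison of the e_i-coordinates in contract (X, u) = w u *: X, first for
   the finitely many u made of unit vectors, so that one neighbourhood suffices *)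
have TX0 : \forall z \near (0 : Kn), forall J i,
    T i z (col_mx (X z) (unit_rows K J)) = a i z * w z (unit_rows K J).
  apply: near_forall => J; apply: near_forall => i.
  suff h : \forall z \near (0 : Kn),
      T i z (col_mx (X z) (unit_rows K J)) - a i z * w z (unit_rows K J) = 0.
    by apply: filterS h => z /eqP; rewrite subr_eq0 => /eqP.
  apply: (indep (a := fun i z =>
     T i z (col_mx (X z) (unit_rows K J)) - a i z * w z (unit_rows K J))) => [j|].
    have hcj : \forall z \near (0 : Kn), forall J, differentiable (c J j) z.
      by apply: near_forall => J'; exact: hc.
    case: dw => hw _ _.
    apply: filterS (filterI (filterI hcj hw) (filterI hX (ha j))) => z [[dc [_ dwz]] [dX da]].
    apply: differentiableB; last exact: differentiable_mul da (dwz _).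
    apply: differentiable_bigsum => J'.
    apply: differentiable_mul; last exact: dc.
    exact: (differentiable_coord_prod (m := q.+1)).
  apply: filterS (filterI TE (filterI XE annX)) => z [Tz [Xz aX]].
  under eq_bigr do rewrite scalerBl -scalerA; rewrite big_split /= sumrN.
  under [X in _ - X]eq_bigr do rewrite scalerA mulrC -scalerA.
  rewrite -scaler_sumr -Xz Tz contract_col_mx ?subrr // => B; exact: aX.
exists (fun z A => (a i0 z)^-1 * T i0 z A).
have an0 : \forall z \near (0 : Kn), a i0 z != 0.
  by apply: near_neq0 a0; exact: nbhs_singleton (ha i0).
split.
  have hci : \forall z \near (0 : Kn), forall J, differentiable (c J i0) z.
    by apply: near_forall => J'; exact: hc.
  apply: filterS (filterI (filterI an0 (ha i0)) (filterI cN hci)) => z [[az da] [cNz dc]].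
  have [mT altT] := coord_form_alternating (fun J x y => cNz J x y i0).
  split; first split.
  - move=> i b A B D h1 h2 h3; rewrite /T (mT i b A B D h1 h2 h3) mulrDr mulrCA //.
  - by move=> i j A ij hA; rewrite /T (altT i j A ij hA) mulr0.
  - move=> A; apply: differentiable_mul; first exact: differentiableV.
    by apply: differentiable_bigsum => J; apply: differentiable_cmul; exact: dc.
apply: filterS (filterI an0 (filterI TX0 det_form_near)) => z [az [Tz [L wL]]] A.
rewrite /interior_product /T coord_form_expand.
under eq_bigr do rewrite -[coord_form _ _]/(T i0 z _) Tz mulrCA.
by rewrite -big_distrr /= mulKf // (form_expand wL).
Qed.
End Form.
End Germs.

(** * Tangent fields with vanishing coordinates *)

Section VanishingCoordinates.
Variable K : numFieldType.
Variable n : nat.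
Local Notation Kn := 'rV[K]_n.

(** The entry is a continuous linear map. *)
Lemma diff_entry (f : Kn -> Kn) z j h : differentiable f z ->
  'd (fun x => f x 0 j : K) z h = 'd f z h 0 j.
Proof.
move=> df.
pose c (N : Kn) : K := N 0 j.
have linc : linear c by move=> a u v; rewrite /c !mxE.
pose c' := GRing.isLinear.Build K Kn K _ c linc.
pose cL : {linear Kn -> K} := HB.pack c c'.
have cc : continuous cL by exact: coord_continuous.
have dc := linear_differentiable (f z) cc.
have E := congr1 (fun u : Kn -> K => u h) (diff_comp df dc).
apply: etrans E _; exact: (congr1 (fun u : Kn -> K => u ('d f z h)) (diff_lin (f z) cc)).
Qed.

Lemma diff_bigsum (I : Type) (s : seq I) (F : I -> Kn -> K) z h :
  (forall i, differentiable (F i) z) ->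
  'd (fun x => \sum_(i <- s) F i x) z h = \sum_(i <- s) 'd (F i) z h.
Proof.
move=> dF; elim: s => [|i s IH].
  rewrite big_nil (_ : (fun _ => _) = cst 0); last by apply/funext => x; rewrite big_nil.
  exact: (congr1 (fun u : Kn -> K => u h) (diff_cst (0 : K) z)).
rewrite big_cons -IH (_ : (fun _ => _) = F i + (fun x => \sum_(j <- s) F j x)).
  exact: (congr1 (fun u : Kn -> K => u h) (diffD (dF i) (differentiable_bigsum s dF))).
by apply/funext => x; rewrite big_cons.
Qed.

Lemma diff_mul_eq0 (f g : Kn -> K) z h : differentiable f z -> differentiable g z -> f z = 0 ->
  'd (fun x => f x * g x) z h = 'd f z h * g z.
Proof.
move=> df dg fz; apply: etrans (congr1 (fun u : Kn -> K => u h) (diffM df dg)) _.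
by rewrite -[LHS]/(f z * 'd g z h + g z * 'd f z h) fz mul0r add0r mulrC.
Qed.
End VanishingCoordinates.

Section ComplexGerms.
Variables (R : realType) (n : nat).
Local Notation C := (Cx R).
Local Notation Cn := 'rV[C]_n.

Lemma diff_near_eq (W : normedModType C) (f g : Cn -> W) z : differentiable g z ->
  (\forall x \near z, f x = g x) -> differentiable f z /\ 'd f z = 'd g z :> (Cn -> W).
Proof.
move=> dg fg; have fgz := nbhs_singleton fg; move: fg => /nbhs_nrmP[d d0 Hd].
apply: nrm_diff; first exact: diff_continuous.
move=> e e0; have [d' d'0 Hd'] := diff_nrm dg e0.
exists (Num.min d d'); first by rewrite lt_min d0.
by move=> h; rewrite lt_min => /andP[/Hd -> /Hd']; rewrite fgz.
Qed.

Definition value_rows r (e : 'I_r -> Cn -> Cn) (z : Cn) : 'M[C]_(r, n) := \matrix_(i < r) e i z.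

(** The rows of the Jacobian are combinations of the e_i(0), as only the terms
    da_i(0) e_i(0) of the product rule survive. *)
Lemma rank_jacobian_vanishing r (e : 'I_r -> Cn -> Cn) (X : Cn -> Cn) (a : 'I_r -> Cn -> C) :
  differentiable X (0 : Cn) -> (forall i, differentiable (e i) (0 : Cn)) ->
  (forall i, differentiable (a i) (0 : Cn)) ->
  (\forall z \near (0 : Cn), X z = \sum_(i < r) a i z *: e i z) -> (forall i, a i 0 = 0) ->
  (\rank ('J X 0%R) <= \rank (value_rows e 0%R))%N.
Proof.
move=> dX de da XE a0; pose D : 'M[C]_(n, r) := \matrix_(s, i) 'd (a i) (0 : Cn) (delta_mx 0 s).
suff -> : 'J X 0%R = D *m value_rows e 0 by exact: mxrankM_maxr.
apply/row_matrixP => s; rewrite [LHS]rowE /jacobian mul_rV_lin1 row_mul mulmx_sum_row.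
apply/rowP => j; rewrite -diff_entry // summxE.
have dae i : differentiable (fun z : Cn => a i z * e i z 0 j) (0 : Cn).
  by apply: differentiable_mul; [exact: da|exact: differentiable_entry].
have E : \forall z \near (0 : Cn), X z 0 j = \sum_(i < r) a i z * e i z 0 j.
  apply: filterS XE => z ->; rewrite summxE; apply: eq_bigr => i _; by rewrite mxE.
have [_ dE] := diff_near_eq (differentiable_bigsum _ dae) E.
apply: etrans (congr1 (fun u : Cn -> C => u (delta_mx 0 s)) dE) _.
apply: etrans (diff_bigsum _ _ dae) _; apply: eq_bigr => i _.
have dei : differentiable (fun z : Cn => e i z 0 j) (0 : Cn) by exact: differentiable_entry.
by apply: etrans (diff_mul_eq0 _ (da i) dei (a0 i)) _; rewrite rowK !mxE.
Qed.

Lemma differentiable_det m (P : Cn -> 'M[C]_m) z :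
  (forall i j, differentiable (fun x => P x i j : C) z) -> differentiable (fun x => \det (P x)) z.
Proof.
move=> dP; rewrite /determinant; apply: differentiable_bigsum => s.
apply: differentiable_cmul; apply: differentiable_bigprod => i; exact: dP.
Qed.

(** The singular set is near 0 the zero set of z |-> w z U, where U completes the
    e_i(0); a left inverse B of the completed family at 0 gives the determinant
    whose nonvanishing says that the family still spans at z. *)
Lemma codim1_vanishing_coords q (w : qform C n q.+1) r (e : 'I_r -> Cn -> Cn) :
  defines_distribution w -> sing w 0 -> (forall i, tangent_field w (e i)) ->
  (n <= \rank (value_rows e 0%R) + q.+1)%N -> False.
Proof.
move=> dw w0 te ler.
have [U [B BU]] := completion ler.
have [hw cod _] := dw.
pose P z := B *m col_mx (value_rows e z) U.
have dP : differentiable (fun z : Cn => \det (P z)) (0 : Cn).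
  apply: differentiable_det => i j.
  rewrite (_ : (fun _ => _) = (fun x => \sum_l B i l * (col_mx (value_rows e x) U) l j)).
    apply: differentiable_bigsum => l; apply: differentiable_cmul.
    case: (split_ordP l) => l' ->.
      rewrite (_ : (fun _ => _) = (fun x => e l' x 0 j)).
        by apply: differentiable_entry; have [hl _] := te l'; exact: nbhs_singleton hl.
      by apply/funext => x; rewrite col_mxEu mxE.
    rewrite (_ : (fun _ => _) = cst (U l' j)); first exact: differentiable_cst.
    by apply/funext => x; rewrite col_mxEd.
  by apply/funext => x; rewrite mxE.
have nP : \forall z \near (0 : Cn), \det (P z) != 0.
  by apply: near_neq0 => //; rewrite /P BU det1 oner_neq0.
apply: (@zeros_codim_le1 R n (fun z => w z U) (sing w)) cod.
- by apply: filterS hw => z [_ dz]; exact: dz.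
- exact: w0.
have ann : \forall z \near (0 : Cn), forall i, forall A, w z (col_mx (e i z) A) = 0.
  by apply: near_forall => i; have [_ ei] := te i.
apply: filterS (filterI nP (filterI ann (det_form_near dw))) => z [Pz [az [L wL]]] wU A.
apply: (det_form_eq0 (E := value_rows e z) (B := B) wL _ _ wU).
  by move=> i A'; rewrite rowK; exact: az.
by rewrite unitmxE unitfE.
Qed.

Lemma free_divides q k (w : qform C n q) (X : Cn -> Cn) : (0 < q)%N -> (n <= k + q)%N ->
  sing w 0 -> defines_distribution w -> free_tangent_sheaf w ->
  holomorphic_near X 0 -> annihilates X w -> (k <= \rank ('J X 0%R))%N -> divides X w.
Proof.
case: q w => // q w _ nk w0 dw [r [e [te gen indep]]] hX aX rk.
have [a [ha XE]] := gen X (conj hX aX).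
have [[i ai]|nex] := pselect (exists i, a i 0 != 0).
  exact: (divides_unit_coord dw gen indep hX aX ha XE ai).
have a0 i : a i 0 = 0.
  by apply/eqP; apply: contrapT => /negP h; apply: nex; exists i.
exfalso; apply: (codim1_vanishing_coords dw w0 te).
apply: leq_trans nk _; rewrite leq_add2r; apply: leq_trans rk _.
apply: rank_jacobian_vanishing XE a0; first exact: nbhs_singleton hX.
- by move=> i; have [hi _] := te i; exact: nbhs_singleton hi.
- by move=> i; exact: nbhs_singleton (ha i).
Qed.
End ComplexGerms.

Theorem corollary5p3 (R : realType) (n k : nat)
    (omega : qform R[i] n (n - k)) (X : 'rV[R[i]]_n -> 'rV[R[i]]_n) :
  (3 <= n)%N -> (1 < k)%N -> (k < n)%N ->
  sing omega 0 ->
  defines_distribution omega ->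
  free_tangent_sheaf omega ->
  holomorphic_near X 0 ->
  annihilates X omega ->
  (k <= \rank ('J X 0%R))%N ->
  divides X omega.
Proof.
move=> _ _ kn; apply: (@free_divides R n (n - k) k omega X).
  by rewrite subn_gt0.
by rewrite subnKC // ltnW.
Qed.
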